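(* Let $(\mathbb{X},d)$ be a metric measure space with a polar decomposition at a point $a\in\mathbb{X}$, let $s>0$ and $2<q<\infty$, with $q'=\frac q{q-1}$. Let $v$ and $z$ be non-negative measurable functions on $\mathbb{X}$, and define $$V(x)=\int_{B(a,|x|_a)}v(y)\,dy,\qquad A(x):=\frac{1}{|B(a,|x|_a)|^{\frac q2}}\left(\int_{B(a,|x|_a)}\frac{v^2(y)}{z(y)}\,dy\right)^{-\frac q2}V^q(x)\,v(x),$$ $$D_1:=\sup_{x\neq a}\left[\left(\int_{\mathbb{X}\setminus B(a,|x|_a)}\frac{A(y)}{|y|_a^{sq}V^q(y)}\,dy\right)^{\frac1q}\left(\int_{B(a,|x|_a)}\left(\frac{A(y)v^{-q}(y)}{|y|_a^{sq}}\right)^{1-q'}dy\right)^{\frac1{q'}}\right],$$ and assume $D_1<\infty$ and $(q')^{\frac1{q'}}q^{\frac1q}D_1<1$. Then there is a constant $C>0$ such that for every measurable $u$ on $\mathbb{X}$ for which $g:=A^{\frac1q}u\,|\cdot|_a^{-s}$ belongs to $L^1(\mathbb{X})\cap L^2(\mathbb{X})\cap L^q(\mathbb{X})$ and is not a.e. zero, $$\|g\|^{4-\frac4q}_{L^2(\mathbb{X})}\le C\left(\int_{\mathbb{X}}\left(\int_{\mathbb{X}}\frac{|u(x)-u(y)|^2z(x)}{d^{2s}(x,y)\left|B\left(a,\frac{d(x,y)}2\right)\right|}dx\right)^{\frac q2}v(y)\,dy\right)^{\frac2q}\|g\|^{\frac{2(q-2)}q}_{L^1(\mathbb{X})}.$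$
   Context: $(\mathbb{X},d)$ is a metric space equipped with a Borel measure $dx$; $|E|$ denotes the measure of a set $E$. $B(a,r)=\{x\in\mathbb{X}: d(x,a)<r\}$ and $|x|_a:=d(a,x)$. ''Polar decomposition at $a$'' means: there is a locally integrable function $\lambda$ such that, with $\Sigma_r=\{x\in\mathbb{X}: d(x,a)=r\}$ equipped with a measure $d\omega_r$, for every $f\in L^1(\mathbb{X})$ one has $\int_{\mathbb{X}}f(x)\,dx=\int_0^\infty\int_{\Sigma_r}f(r,\omega)\lambda(r,\omega)\,d\omega_r\,dr$. The constant $C$ is independent of $u$. *)

(* Defs.v *)
From HB Require Import structures.
From mathcomp Require Import all_boot all_order all_algebra.
From mathcomp Require Import all_classical all_reals all_analysis.
From mathcomp Require Import measurable_realfun.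
Set Implicit Arguments. Unset Strict Implicit. Unset Printing Implicit Defensive.
Import Order.TTheory GRing.Theory Num.Theory.
Import numFieldNormedType.Exports.
Local Open Scope classical_set_scope.
Local Open Scope ring_scope.

Section MetricMeasure.
Context {R : realType} {d : measure_display} {T : measurableType d}.
Variable (mu : {measure set T -> \bar R}) (dist : T -> T -> R).

Definition is_metric : Prop :=
  (forall x y, 0 <= dist x y) /\ (forall x y, dist x y = 0 <-> x = y) /\
  (forall x y, dist x y = dist y x) /\
  (forall x y w, dist x w <= dist x y + dist y w).

Definition mball (a : T) (r : R) : set T := [set x | dist x a < r].

Definition msphere (a : T) (r : R) : set T := [set x | dist x a = r].

Definition metric_open (U : set T) : Prop :=
  forall x, U x -> exists r, 0 < r /\ mball x r `<=` U.

Definition borel_sets_measurable : Prop :=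
  forall U, metric_open U -> measurable U.

Definition polar_decomposition (a : T) : Prop :=
  exists (lambda : R -> T -> R) (sigma : R -> {measure set T -> \bar R}),
    (forall r0 : R, 0 < r0 ->
       (\int[lebesgue_measure]_(r in [set r : R | (0 <= r <= r0)%R])
          \int[sigma r]_(x in msphere a r) `|lambda r x|%:E < +oo)%E) /\
    (forall f : T -> R, mu.-integrable setT (EFin \o f) ->
       (\int[mu]_x (f x)%:E =
        \int[lebesgue_measure]_(r in [set r : R | (0 <= r)%R])
          \int[sigma r]_(x in msphere a r) (f x * lambda r x)%:E)%E).

Local Open Scope ereal_scope.

Variable (a : T) (s q : R) (v z : T -> R).

Definition Bx (x : T) : set T := mball a (dist a x).

Definition Vfun (x : T) : \bar R := \int[mu]_(y in Bx x) (v y)%:E.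

Definition Ifun (x : T) : \bar R :=
  \int[mu]_(y in Bx x) ((v y ^+ 2)%:E * ((z y)%:E)^-1).

Definition Afun (x : T) : \bar R :=
  (mu (Bx x) `^ (q / 2))^-1 * (Ifun x `^ (q / 2))^-1 * (Vfun x `^ q)
  * (v x)%:E.

Definition qconj : R := (q / (q - 1))%R.

Definition D1_at (x : T) : \bar R :=
  (\int[mu]_(y in ~` Bx x)
      (Afun y * ((dist a y `^ (s * q))%:E * Vfun y `^ q)^-1)) `^ (q^-1)
  * (\int[mu]_(y in Bx x)
      ((Afun y * ((v y `^ q)%:E)^-1 * ((dist a y `^ (s * q))%:E)^-1)
         `^ (qconj - 1))^-1) `^ (qconj^-1).

Definition D1 : \bar R := ereal_sup [set D1_at x | x in [set x | x != a]].

Definition gfun (u : T -> R) (x : T) : \bar R :=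
  Afun x `^ (q^-1) * ((u x)%:E * ((dist a x `^ s)%:E)^-1).

Definition inLp (p : R) (f : T -> \bar R) : Prop :=
  measurable_fun setT f /\ \int[mu]_x (`|f x| `^ p) < +oo.

Definition enorm (p : R) (f : T -> \bar R) : \bar R :=
  (\int[mu]_x (`|f x| `^ p)) `^ (p^-1).

Definition energy (u : T -> R) : \bar R :=
  \int[mu]_y ((\int[mu]_x (((u x - u y) ^+ 2 * z x)%:E *
        ((dist x y `^ (2 * s))%:E * mu (mball a (dist x y / 2)))^-1))
      `^ (q / 2) * (v y)%:E).

End MetricMeasure.

(* Main.v *)
Require Import Defs.
From HB Require Import structures.
From mathcomp Require Import all_boot all_order all_algebra.
From mathcomp Require Import all_classical all_reals all_analysis.
From mathcomp Require Import measurable_realfun.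
From mathcomp Require Import ring lra.
Import Order.TTheory GRing.Theory Num.Theory.
Import numFieldNormedType.Exports.
Local Open Scope classical_set_scope.
Local Open Scope ring_scope.

(** With rho := d(a, .), every ball B(a, |y|_a) is {rho < rho y}. For x in it,
    d(x, y) < 2 rho y, so the kernel of the energy is at least
    (2 rho y)^(-2s) / |B(a, |y|_a)|; Cauchy-Schwarz with weights z and v^2 / z
    then bounds the energy below by a constant times the integral of
    A rho^(-sq) |u - V^-1 \int_B u v|^q. The average is absorbed by the weighted
    Hardy inequality, whose sharp constant (q')^(1/q') q^(1/q) D_1 is less than 1.
    This gives ||g||_q^q <= C energy, and interpolating L^2 between L^1 and L^q
    concludes. The Hardy inequality is Muckenhoupt's: Hoelder with the power
    1/(q q') of the mass of closed balls, exchange of the integrals, and two uses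
    of "the integral of W^(a - 1) dW is at most W^a / a" for tail masses W. *)

(** [mu] is not assumed sigma-finite and [dist] is not assumed jointly measurable, so the usual
    Fubini theorem cannot be applied. The order along [rho] replaces it: balls and tails are
    down-sets and up-sets of [rho], and anything monotone in [rho] is measurable. The lemmas along
    [rho] allow level sets of positive mass. There the integral of [W^(a - 1) dW] obeys only an
    inequality, and only when [W] counts the mass at its own level: with [a < 1] the closed tail,
    being the larger one, gives the smaller weight. Hence closed tails and closed balls in the
    auxiliary weights, although the balls of the theorem are open. All quantities live in [[0, +oo]]
    with [0^-1 = +oo] and [0 * +oo = 0], and [A] may vanish or be infinite. Pointwise identities are
    therefore asked only where the relevant factors are finite. The absorption splits the q-th power
    of a sum with weights [1 - k] and [k], where [k < 1] bounds the Hardy constant. The Hardy term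
    then returns exactly [k] times [||g||_q^q], which can be subtracted because [g] lies in
    [L^q]. *)

Section AlongRadius.
Context {R : realType} {d : measure_display} {T : measurableType d}.
Implicit Types (rho : T -> R) (U : set T) (w : T -> \bar R).

Definition upset rho U := forall x y, U x -> rho x <= rho y -> U y.

(** Three cases: [rho] attains its infimum on [U], has an unattained one, or is unbounded below;
    [c n] is then the minimum, [inf + 1/(n+1)], or [-n]. The points of [U] with [rho y <= c n] let a
    bound known only on [U] control the closed tails that exhaust it. *)
Lemma upset_cofinal rho U : upset rho U -> U !=set0 ->
  exists c : nat -> R, [/\ {homo c : m n / (m <= n)%N >-> n <= m},
    (forall n, exists2 y, U y & rho y <= c n) &
    U = \bigcup_n [set x | c n <= rho x]].
Proof.
move=> upU [x0 Ux0].
have sub (c : nat -> R) : (forall n, exists2 y, U y & rho y <= c n) ->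
    (forall x, U x -> exists n, c n <= rho x) ->
    U = \bigcup_n [set x | c n <= rho x].
  move=> cP Pc; apply/seteqP; split=> x; first by move/Pc => [n ?]; exists n.
  by move=> [n _ /= cx]; have [y Uy yc] := cP n; exact: (upU y x Uy (le_trans yc cx)).
have [[y [Uy ymin]]|nomin] :=
  pselect (exists y, U y /\ forall x, U x -> rho y <= rho x).
  exists (fun=> rho y); split=> //; first by move=> n; exists y.
  by apply: sub => [n|x Ux]; [exists y|exists 0%N; exact: ymin].
have [lbS|nlbS] := pselect (has_lbound (rho @` U)).
  have iS : has_inf (rho @` U) by split => //; exists (rho x0), x0.
  have H n : exists2 y, U y & rho y <= inf (rho @` U) + n.+1%:R^-1.
    have [|_ [y Uy <-] /ltW ?] := @inf_adherent _ _ n.+1%:R^-1 _ iS.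
      by rewrite invr_gt0 ltr0n.
    by exists y.
  exists (fun n => inf (rho @` U) + n.+1%:R^-1); split => //.
    by move=> m n mn; rewrite lerD2l lef_pV2 ?posrE ?ltr0n// ler_nat.
  apply: sub => // x Ux.
  have lt_inf : inf (rho @` U) < rho x.
    rewrite lt_neqAle; apply/andP; split; last first.
      by apply: ge_inf => //; exists x.
    apply/eqP => E; apply: nomin; exists x; split => // y Uy; rewrite -E.
    by apply: ge_inf => //; exists y.
  have : 0 < rho x - inf (rho @` U) by rewrite subr_gt0.
  move=> /ltr_add_invr[n].
  by rewrite add0r => /ltW h; exists n; rewrite addrC -lerBrDr.
have H n : exists2 y, U y & rho y <= - n%:R.
  apply: contrapT => nex; apply: nlbS; exists (- n%:R) => _ [y Uy <-].
  by rewrite leNgt; apply/negP => /ltW ?; apply: nex; exists y.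
exists (fun n => - n%:R); split => //.
  by move=> m n mn; rewrite lerN2 ler_nat.
apply: sub => // x Ux; exists (Num.bound `|rho x|).
by rewrite lerNl (le_trans (ler_norm _))// normrN ltW// archi_boundP.
Qed.

Lemma measurable_upset rho U :
  measurable_fun setT rho -> upset rho U -> measurable U.
Proof.
move=> mrho upU; have [->//|/set0P U0] := eqVneq U set0.
have [c [_ _ ->]] := upset_cofinal _ _ upU U0.
apply: bigcup_measurable => n _.
have := mrho measurableT _ (measurable_itv `[c n, +oo[); rewrite setTI.
by congr measurable; apply/seteqP; split => x /=; rewrite in_itv/= andbT.
Qed.

(** The superlevel sets of [phi] are upsets. Integrals over balls and tails, as functions of the
    centre point, get their measurability from here; decreasing ones are handled through [- rho]. *)
Lemma measurable_along rho (phi : T -> \bar R) : measurable_fun setT rho ->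
  (forall x y, rho x <= rho y -> (phi x <= phi y)%E) -> measurable_fun setT phi.
Proof.
move=> mrho phi_le.
apply: (measurability _ (ErealGenOInfty.measurableE R)) => //.
move=> _ [_ [r ->] <-]; rewrite setTI.
apply: (measurable_upset rho) => // x y /=; rewrite !in_itv/= !andbT => xr xy.
exact: (lt_le_trans xr (phi_le _ _ xy)).
Qed.

Variable mu : {measure set T -> \bar R}.

(** The tail is closed, as the complement of the open ball in [D1_at] is. With [- rho] in place of
    [rho] it becomes the mass of a closed ball. *)
Definition tail rho w (x : T) : \bar R :=
  \int[mu]_(y in [set y | rho x <= rho y]) w y.

Lemma integral_upset_le rho U w (c : \bar R) : measurable_fun setT rho ->
  measurable_fun setT w -> (forall x, 0 <= w x)%E -> upset rho U ->
  (0 <= c)%E -> (forall y, U y -> tail rho w y <= c)%E ->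
  (\int[mu]_(x in U) w x <= c)%E.
Proof.
move=> mrho mw w0 upU c0 Uc; have [->|/set0P U0] := eqVneq U set0.
  by rewrite integral_set0.
have [b [bn bU UE]] := upset_cofinal _ _ upU U0.
have mF i : measurable [set x | b i <= rho x].
  by apply: (measurable_upset rho) => // x y /=; exact: le_trans.
have sF : {homo (fun n => [set x | b n <= rho x]) : m n / (m <= n)%N >-> (m <= n)%O}.
  by move=> m n mn; apply/subsetPset => x /=; exact: le_trans (bn _ _ mn).
have := @ge0_nondecreasing_set_cvg_integral _ _ _ _ w mu sF mF.
rewrite -UE => /(_ (fun i => measurable_funTS mw) (fun i x _ => w0 x)) cv.
rewrite -(cvg_lim _ cv)//; apply: lime_le; first by apply/cvg_ex; eexists; exact: cv.
apply: nearW => n; have [y Uy yb] := bU n; apply: le_trans (Uc _ Uy).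
apply: ge0_subset_integral => //.
- by apply: (measurable_upset rho) => // x z /=; exact: le_trans.
- exact: measurable_funTS.
- by move=> x /=; exact: le_trans.
Qed.

End AlongRadius.

Lemma weighted_amgm {R : realType} (a b x y : R) : 0 < a -> 0 < b -> a + b = 1 ->
  0 <= x -> 0 <= y -> x `^ a * y `^ b <= a * x + b * y.
Proof.
move=> a0 b0 ab x0 y0.
have := @conjugate_powR R (x `^ a) (y `^ b) a^-1 b^-1 (powR_ge0 _ _) (powR_ge0 _ _).
rewrite !invr_gt0 !invrK -!powRrM !mulfV ?gt_eqF// !powRr1// => /(_ a0 b0 ab).
by rewrite [x * a]mulrC [y * b]mulrC.
Qed.

Lemma measurable_inve {R : realType} {d} {T : measurableType d} (f : T -> \bar R) :
  measurable_fun setT f -> (forall x, 0 <= f x)%E ->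
  measurable_fun setT (fun x => (f x)^-1)%E.
Proof.
move=> mf f0; apply: (measurability _ (ErealGenOInfty.measurableE R)) => //.
move=> _ [_ [r ->] <-]; rewrite setTI.
have [r0|r0] := ltP r 0.
  rewrite (_ : _ @^-1` _ = setT)//; apply/seteqP; split => // x _ /=.
  by rewrite in_itv/= andbT (@lt_le_trans _ _ 0%E)// ?lte_fin// inve_ge0.
have := emeasurable_fun_infty_o (f := f) measurableT mf (r%:E^-1)%E.
rewrite setTI.
suff -> : (fun x => (f x)^-1)%E @^-1` `]r%:E, +oo[%classic =
   [set x | (f x < r%:E^-1)%E] by [].
apply/seteqP; split => x /=; rewrite in_itv/= andbT inve_pgt// ?inE ?lee_fin//.
Qed.

Lemma integral_mul_mine_le {R : realType} {d} {T : measurableType d}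
    (mu : {measure set T -> \bar R}) (D : set T) (w F : T -> \bar R)
    (K : nat -> R) (c : \bar R) :
  measurable D -> measurable_fun setT w -> measurable_fun setT F ->
  (forall x, 0 <= w x)%E -> (forall x, 0 <= F x)%E ->
  {homo K : m n / (m <= n)%N >-> m <= n} -> (forall n, 0 <= K n) ->
  K @ \oo --> +oo ->
  (forall n, \int[mu]_(x in D) (w x * mine (F x) (K n)%:E) <= c)%E ->
  (\int[mu]_(x in D) (w x * F x) <= c)%E.
Proof.
move=> mD mw mF w0 F0 Kn K0 Ky Hc.
have ndm x : {homo (fun n => (w x * mine (F x) (K n)%:E)%E) : m n / (m <= n)%N >-> (m <= n)%E}.
  by move=> m n mn; apply: lee_wpmul2l => //; rewrite le_min !ge_min lexx/= lee_fin Kn// orbT.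
have cv x : (w x * mine (F x) (K n)%:E)%E @[n --> \oo] --> (w x * F x)%E.
  (* A null weight is set apart: where [F x = +oo], the product is not continuous at [0 * +oo]. *)
  have [->|wx0] := eqVneq (w x) 0%E.
    by rewrite mul0e; under eq_fun do rewrite mul0e; exact: cvg_cst.
  have [Fy|Fy] := eqVneq (F x) +oo%E.
    rewrite Fy; under eq_fun do rewrite minye.
    by apply: cvgeM; [by rewrite mule_defE negb_or !negb_and wx0|exact: cvg_cst|exact/cvgeryP].
  have Ff : F x \is a fin_num by rewrite ge0_fin_numE// ltey.
  apply: cvg_near_cst; move/cvgryPge : Ky => /(_ (fine (F x))).
  by apply: filterS => n Fn; rewrite min_l// -(fineK Ff) lee_fin.
rewrite (eq_integral (fun x => limn (fun n => w x * mine (F x) (K n)%:E)%E)); last first.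
  by move=> x _; apply/esym/cvg_lim.
have mm n : measurable_fun D (fun x => w x * mine (F x) (K n)%:E)%E.
  apply: emeasurable_funM; first exact: measurable_funTS.
  by apply: measurable_mine => //; exact: measurable_funTS.
rewrite monotone_convergence//; last first.
  by move=> n x _; rewrite mule_ge0// le_min F0 lee_fin K0.
apply: lime_le; last exact: nearW.
apply: ereal_nondecreasing_is_cvgn => m n mn.
apply: ge0_le_integral => //; last by move=> x _; exact: ndm.
by move=> x _; rewrite mule_ge0// le_min F0 lee_fin K0.
Qed.

(** Weighted AM-GM with a free parameter [t] is integrated first and optimised afterwards. Where [Q]
    is infinite the integrated bound is trivial, so the pointwise hypothesis can be restricted to
    finite [Q]; this spares the applications every product [0 * +oo] at points of infinite
    weight. *)
Lemma hoelder_ae {R : realType} {d} {T : measurableType d}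
    (mu : {measure set T -> \bar R}) (D : set T) (f P Q : T -> \bar R) (a b : R) :
  measurable D -> measurable_fun setT f -> measurable_fun setT P ->
  measurable_fun setT Q -> (forall x, 0 <= f x)%E -> (forall x, 0 <= P x)%E ->
  (forall x, 0 <= Q x)%E -> 0 < a -> 0 < b -> a + b = 1 ->
  (\int[mu]_(x in D) Q x < +oo)%E ->
  {ae mu, forall x, D x -> (Q x < +oo)%E -> (f x <= P x `^ a * Q x `^ b)%E} ->
  (\int[mu]_(x in D) f x <=
     (\int[mu]_(x in D) P x) `^ a * (\int[mu]_(x in D) Q x) `^ b)%E.
Proof.
move=> mD mf mP mQ f0 P0 Q0 a0 b0 ab Qoo H.
set A := (\int[mu]_(x in D) P x)%E; set B := (\int[mu]_(x in D) Q x)%E.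
have A0 : (0 <= A)%E by exact: integral_ge0.
have B0 : (0 <= B)%E by exact: integral_ge0.
have mfD (g : T -> \bar R) : measurable_fun setT g -> measurable_fun D g by exact: measurable_funTS.
have young t : 0 < t ->
    (\int[mu]_(x in D) f x <= (a * t `^ b)%:E * A + (b * t `^ (- a))%:E * B)%E.
  move=> t0.
  have c1 : 0 < a * t `^ b by rewrite mulr_gt0// powR_gt0.
  have c2 : 0 < b * t `^ (- a) by rewrite mulr_gt0// powR_gt0.
  rewrite -!ge0_integralZl//; [|exact: mfD|by rewrite lee_fin ltW|exact: mfD|by rewrite lee_fin ltW].
  rewrite -ge0_integralD//;
    [|by move=> x _; rewrite mule_ge0// lee_fin ltW
     |by apply: emeasurable_funM => //; exact: mfD
     |by move=> x _; rewrite mule_ge0// lee_fin ltW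
     |by apply: emeasurable_funM => //; exact: mfD].
  apply: ae_ge0_le_integral => //.
  - exact: mfD.
  - by move=> x _; rewrite adde_ge0// mule_ge0// lee_fin ltW.
  - by apply: emeasurable_funD; apply: emeasurable_funM => //; exact: mfD.
  apply: filterS H => x Hx Dx.
  have [Qx|Qx] := eqVneq (Q x) +oo%E.
    by rewrite Qx gt0_muley ?lte_fin// addey ?leey// gt_eqF// (@lt_le_trans _ _ 0%E)// mule_ge0// lee_fin ltW.
  have [Px|Px] := eqVneq (P x) +oo%E.
    by rewrite Px gt0_muley ?lte_fin// addye ?leey// gt_eqF// (@lt_le_trans _ _ 0%E)// mule_ge0// lee_fin ltW.
  have {}Hx := Hx Dx; rewrite ltey in Hx; apply: le_trans (Hx Qx) _.
  move: Px Qx (P0 x) (Q0 x); case: (P x) => [p| |]//; case: (Q x) => [r| |]// _ _.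
  rewrite !lee_fin => p0 r0.
  have tp s : t `^ s != 0 by rewrite gt_eqF// powR_gt0.
  have := weighted_amgm _ _ (t `^ b * p) (t `^ (- a) * r) a0 b0 ab.
  rewrite !mulr_ge0 ?powR_ge0// => /(_ isT isT).
  rewrite !powRM ?powR_ge0// -!powRrM mulNr (powRN t (a * b)) [b * a]mulrC.
  by rewrite mulrACA mulfV// mul1r !mulrA.
have [B00|Bn0] := eqVneq B 0%E.
  rewrite B00 poweR0r ?gt_eqF// mule0.
  have /ae_eq_integral_abs : (\int[mu]_(x in D) `|Q x| = 0)%E.
    by rewrite -[RHS]B00; apply: eq_integral => x _; rewrite gee0_abs.
  move=> /(_ mD (mfD _ mQ)) Qae.
  rewrite -(integral0 mu D); apply: ae_ge0_le_integral => //; first exact: mfD.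
  apply: filterS2 H Qae => x Hx Qx Dx.
  have {}Qx : Q x = 0%E by rewrite Qx.
  by apply: le_trans (Hx Dx _) _; rewrite Qx// poweR0r ?gt_eqF// mule0.
have [Ay|An] := eqVneq A +oo%E.
  by rewrite Ay poweRyr ?gt_eqF// gt0_mulye ?leey// poweR_gt0// lt0e Bn0.
move: young A0 B0 Qoo Bn0 An; rewrite -/A -/B.
case: A => [A| |]//; case: B => [B| |]// young; rewrite !lee_fin => A0 B0 _ Bn0 _.
have {Bn0}B_gt0 : 0 < B by rewrite lt0r B0 andbT; exact: Bn0.
rewrite !poweR_EFin -EFinM.
have [A00|An0] := eqVneq A 0.
  rewrite A00 powR0 ?gt_eqF// mul0r; apply/lee_addgt0Pr => e e0; rewrite add0e.
  have e1 : 0 < e / (b * B) by rewrite divr_gt0// mulr_gt0.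
  (* When [A = 0] only the second term survives; this [t] makes it equal to [e]. *)
  apply: le_trans (young ((e / (b * B)) `^ (- a^-1)) (powR_gt0 _ e1)) _.
  rewrite A00 mule0 add0e -EFinM lee_fin -powRrM mulrNN mulVf ?gt_eqF// powRr1 ?(ltW e1)//.
  rewrite [leLHS](_ : _ = e)//; field; rewrite !gt_eqF//.
have A_gt0 : 0 < A by rewrite lt0r A0 An0.
(* The optimal parameter: both terms become multiples of [A^a * B^b], with factors [a] and [b] of
   sum 1. *)
apply: le_trans (young (B / A) (divr_gt0 B_gt0 A_gt0)) _.
rewrite -!EFinM -EFinD lee_fin.
have -> : b = 1 - a by rewrite -ab addrAC subrr add0r.
have eA s : A `^ s = expR (s * ln A) by rewrite /powR gt_eqF.
have eB s : B `^ s = expR (s * ln B) by rewrite /powR gt_eqF.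
have eAB s : (B / A) `^ s = expR (s * (ln B - ln A)).
  by rewrite /powR gt_eqF ?divr_gt0// ln_div.
have E1 : (B / A) `^ (1 - a) * A = A `^ a * B `^ (1 - a).
  rewrite eAB eA eB -[X in _ * X = _](lnK A_gt0) -!expRD; congr expR; ring.
have E2 : (B / A) `^ (- a) * B = A `^ a * B `^ (1 - a).
  rewrite eAB eA eB -[X in _ * X = _](lnK B_gt0) -!expRD; congr expR; ring.
by rewrite -!mulrA E1 E2 -mulrDl addrC subrK mul1r.
Qed.

(** * Powers of tail masses as integration weights *)

Section TailPower.
Context {R : realType} {d : measure_display} {T : measurableType d}.
Variable (mu : {measure set T -> \bar R}).
Implicit Types (rho : T -> R) (U : set T) (w : T -> \bar R).

Lemma tail_ge0 rho w x : (forall x, 0 <= w x)%E -> (0 <= tail mu rho w x)%E.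
Proof. by move=> w0; exact: integral_ge0. Qed.

Lemma measurable_tail rho w : measurable_fun setT rho -> measurable_fun setT w ->
  (forall x, 0 <= w x)%E -> measurable_fun setT (tail mu rho w).
Proof.
move=> mrho mw w0; apply: (measurable_along (fun x => - rho x)).
  exact: measurableT_comp.
move=> x y; rewrite lerN2 => yx; apply: ge0_subset_integral => //.
- by apply: (measurable_upset rho) => // u v /=; exact: le_trans.
- by apply: (measurable_upset rho) => // u v /=; exact: le_trans.
- exact: measurable_funTS.
- by move=> u /=; exact: le_trans.
Qed.

Lemma measurable_poweR_fun (f : T -> \bar R) r : measurable_fun setT f ->
  measurable_fun setT (fun x => (f x `^ r)%E).
Proof. by move=> mf; exact: (measurableT_comp (measurable_poweR r)). Qed.

Lemma le_poweR (x y : \bar R) r : 0 <= r -> (0 <= x)%E -> (x <= y)%E ->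
  (x `^ r <= y `^ r)%E.
Proof.
move=> r0 x0 xy; apply: (gt0_ler_poweR r0) => //; rewrite in_itv/= leey andbT//.
exact: le_trans xy.
Qed.

Lemma le_inve (x y : \bar R) : (0 <= x)%E -> (x <= y)%E -> (y^-1 <= x^-1)%E.
Proof.
by move=> x0 xy; rewrite inve_ple ?inE ?inve_ge0 ?inveK//; exact: le_trans xy.
Qed.

(* The weight is written [(W `^ b)^-1] and not [W `^ (- b)] because the library
   sets [+oo `^ r = +oo] for negative [r] too.
   Layer cake over the geometric levels [M * th ^ n]: the tail exceeds level t
   except on a set of [w]-mass at most t. Bernoulli's inequality makes the
   constant of the geometric sum at most [1 / a], up to a factor B -> 1. *)
Lemma integral_tail_poweRV rho U w a b : measurable_fun setT rho ->
  measurable_fun setT w -> (forall x, 0 <= w x)%E -> upset rho U ->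
  0 < a -> 0 < b -> a + b = 1 ->
  (\int[mu]_(x in U) (w x * (tail mu rho w x `^ b)^-1) <=
   (a^-1)%:E * (\int[mu]_(x in U) w x) `^ a)%E.
Proof.
move=> mrho mw w0 upU a0 b0 ab.
have mU : measurable U by exact: measurable_upset upU.
set W := tail mu rho w; set F := fun x => ((W x `^ b)^-1)%E.
have W0 x : (0 <= W x)%E by exact: tail_ge0.
have F0 x : (0 <= F x)%E by rewrite inve_ge0 poweR_ge0.
have mW : measurable_fun setT W by exact: measurable_tail.
have mF : measurable_fun setT F.
  apply: measurable_inve => [|x]; last exact: poweR_ge0.
  exact: measurable_poweR_fun.
have [My|Mfin] := eqVneq (\int[mu]_(x in U) w x)%E +oo%E.
  by rewrite My poweRyr ?gt_eqF// gt0_muley ?leey// lte_fin invr_gt0.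
have M0 : (0 <= \int[mu]_(x in U) w x)%E by exact: integral_ge0.
have [M ME] : exists M, (\int[mu]_(x in U) w x = M%:E)%E.
  by exists (fine (\int[mu]_(x in U) w x)%E); rewrite fineK// ge0_fin_numE// ltey.
move: M0; rewrite ME lee_fin => M0.
have [M00|Mn0] := eqVneq M 0.
  have /ae_eq_integral_abs : (\int[mu]_(x in U) `|w x| = 0)%E.
    by under eq_integral do rewrite gee0_abs//; rewrite ME M00.
  move=> /(_ mU (measurable_funTS mw)) wae.
  rewrite (ae_eq_integral (cst 0%E)) ?integral0 ?mule_ge0 ?poweR_ge0 ?lee_fin ?invr_ge0 ?ltW//.
    by apply: emeasurable_funM; exact: measurable_funTS.
  by apply: filterS wae => x wx Ux; rewrite wx// mul0e.
have M_gt0 : 0 < M by rewrite lt0r Mn0.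
rewrite poweR_EFin -EFinM; apply/lee_mul01Pr.
  by apply: integral_ge0 => x _; exact: mule_ge0 (w0 x) (F0 x).
move=> r /andP[r0 r1].
(* The slack [r] is [1 / B]. Truncation levels [K n] of the weight grow by [B] while tail levels
   [t n] shrink by [th], where [th^b = r]: a tail of [t n] corresponds exactly to a weight of [K n].
   The increments of the truncated integral then form a geometric series of ratio [p = th * B]. *)
pose B := r^-1; pose th := B `^ (- b^-1); pose p := th `^ a.
have B1 : 1 < B by rewrite invf_gt1.
have B_gt0 : 0 < B by rewrite invr_gt0.
have th0 : 0 < th by rewrite powR_gt0.
have p0 : 0 < p by rewrite powR_gt0.
have thb : th `^ b = r by rewrite /th -powRrM mulNr mulVf ?gt_eqF// powR_inv1 ?invrK// ltW.
have pB : th = p * r.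
  by rewrite -thb /p -powRD ?ab ?powRr1 ?ltW// oner_eq0.
have th1 : th < 1.
  rewrite ltNge; apply/negP => th1; have := @ge0_ler_powR R b (ltW b0) 1 th.
  by rewrite !nnegrE ler01 ltW// => /(_ isT isT th1); rewrite powR1 thb leNgt r1.
have p1 : a * (1 - th) <= 1 - p.
  have := @weighted_amgm R a b th 1 a0 b0 ab (ltW th0) ler01.
  by rewrite powR1 !mulr1 -/p; lra.
have p1_gt0 : 0 < 1 - p.
  by apply: lt_le_trans p1; rewrite mulr_gt0// subr_gt0.
pose K n := (M `^ b)^-1 * B ^+ n.
have K_gt0 n : 0 < K n by rewrite mulr_gt0// ?invr_gt0 ?powR_gt0// exprn_gt0.
pose t n := M * th ^+ n.
have t_gt0 n : 0 < t n by rewrite mulr_gt0// exprn_gt0.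
have tK n : ((t n `^ b)%:E^-1 = (K n)%:E)%E.
  rewrite inver gt_eqF ?powR_gt0// powRM ?exprn_ge0 ?ltW// -powR_mulrn ?ltW//.
  by rewrite -powRrM [n%:R * _]mulrC powRrM thb powR_mulrn ?ltW// invfM -exprVn.
have Kt n : (B - 1) * K n * t n = M `^ a * (B - 1) * p ^+ n.
  have -> : p = th * B by rewrite pB -mulrA /B mulfV ?mulr1// gt_eqF.
  rewrite /K /t exprMn.
  have {2}-> : M = M `^ a * M `^ b by rewrite -powRD ?ab ?powRr1 ?ltW// oner_eq0.
  by field; rewrite gt_eqF// powR_gt0.
have mwK n : measurable_fun U (fun x => w x * mine (F x) (K n)%:E)%E.
  apply: emeasurable_funM; first exact: measurable_funTS.
  by apply: measurable_mine => //; exact: measurable_funTS.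
have wK0 n x : (0 <= w x * mine (F x) (K n)%:E)%E.
  by rewrite mule_ge0// le_min F0 lee_fin ltW.
have bound n : (\int[mu]_(x in U) (w x * mine (F x) (K n)%:E) <=
    (M `^ a * (1 + (B - 1) * (1 - p ^+ n) / (1 - p)))%:E)%E.
  elim: n => [|n IH].
    rewrite expr0 subrr mulr0 mul0r addr0 mulr1.
    apply: (@le_trans _ _ (\int[mu]_(x in U) ((K 0)%:E * w x))%E).
      apply: ge0_le_integral => //.
        by apply: emeasurable_funM => //; exact: measurable_funTS.
      by move=> x _; rewrite muleC lee_wpmul2r// ge_min lexx orbT.
    rewrite ge0_integralZl//; [|exact: measurable_funTS|by rewrite lee_fin ltW].
    rewrite ME -EFinM lee_fin /K expr0 mulr1.
    have {2}-> : M = M `^ a * M `^ b by rewrite -powRD ?ab ?powRr1 ?ltW// oner_eq0.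
    by rewrite mulrCA mulVf ?mulr1// gt_eqF// powR_gt0.
  (* Raising the truncation from [K n] to [K n.+1] changes the integrand only on [V], by at most
     [(B - 1) * K n * w]. *)
  pose V := [set x | (W x <= (t n)%:E)%E].
  have upV : upset rho V.
    move=> x y /= Wx xy; apply: le_trans Wx; apply: ge0_subset_integral => //.
    - by apply: (measurable_upset rho) => // u v /=; exact: le_trans.
    - by apply: (measurable_upset rho) => // u v /=; exact: le_trans.
    - exact: measurable_funTS.
    - by move=> u /=; exact: le_trans.
  have mV : measurable V by exact: measurable_upset upV.
  have mwV : measurable_fun setT (w \_ V).
    by apply/(measurable_restrictT _ mV); exact: measurable_funTS.
  have wV0 x : (0 <= (w \_ V) x)%E by apply: erestrict_ge0.
  have KB : K n.+1 = K n + (B - 1) * K n by rewrite /K exprS; ring.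
  have c0 : 0 <= (B - 1) * K n by rewrite mulr_ge0 ?ltW// subr_gt0.
  apply: (@le_trans _ _ (\int[mu]_(x in U) (w x * mine (F x) (K n)%:E +
      ((B - 1) * K n)%:E * (w \_ V) x))%E).
    apply: ge0_le_integral => //.
      apply: emeasurable_funD => //.
      by apply: emeasurable_funM => //; exact: measurable_funTS.
    move=> x _; have [Vx|/= Vx] := pselect (V x).
      have FK : ((K n)%:E <= F x)%E.
        by rewrite -tK /F le_inve ?poweR_ge0// -poweR_EFin le_poweR ?(ltW b0).
      rewrite patchE mem_set// (min_r FK) ![(w x * _)%E]muleC.
      rewrite -ge0_muleDl ?lee_fin ?(ltW (K_gt0 n))//.
      by rewrite lee_wpmul2r// ge_min -EFinD -KB lexx orbT.
    have -> : (w \_ V) x = 0%E by rewrite patchE memNset.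
    rewrite mule0 adde0 (min_l (_ : (F x <= (K n)%:E)%E)); last first.
      rewrite -tK /F le_inve ?lee_fin ?powR_ge0//.
      rewrite -poweR_EFin le_poweR ?(ltW b0) ?lee_fin ?(ltW (t_gt0 n))//.
      by apply: ltW; rewrite ltNge; exact/negP.
    by rewrite lee_wpmul2l// ge_min lexx.
  rewrite ge0_integralD//; last 2 first.
    by move=> x _; rewrite mule_ge0.
    by apply: emeasurable_funM => //; exact: measurable_funTS.
  rewrite ge0_integralZl//; last exact: measurable_funTS.
  rewrite -integral_mkcondr.
  have Ut : (\int[mu]_(x in U `&` V) w x <= (t n)%:E)%E.
    apply: (integral_upset_le mu rho) => //.
    - by move=> x y [Ux Vx] xy; split; [exact: upU xy|exact: upV xy].
    - by rewrite lee_fin ltW.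
    - by move=> y [].
  apply: le_trans (leeD IH (lee_wpmul2l _ Ut)) _; first by rewrite lee_fin.
  rewrite -EFinM -EFinD lee_fin Kt exprS.
  rewrite [leLHS](_ : _ = M `^ a * (1 + (B - 1) * (1 - p * p ^+ n) / (1 - p)))//.
  by field; rewrite gt_eqF.
have Kgrow n : (B - 1) * n%:R <= B ^+ n.
  elim: n => [|n IH]; first by rewrite mulr0 expr0.
  have Bn : 1 <= B ^+ n by rewrite exprn_ege1// ltW.
  have : (B - 1) * 1 <= (B - 1) * B ^+ n by rewrite ler_wpM2l// subr_ge0 ltW.
  by rewrite -natr1 exprS; lra.
have : (\int[mu]_(x in U) (w x * F x) <= (M `^ a * (1 + (B - 1) / (1 - p)))%:E)%E.
  apply: (integral_mul_mine_le _ _ _ _ K) => //.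
  - move=> m n mn; rewrite ler_wpM2l ?invr_ge0 ?powR_ge0//.
    by rewrite ler_weXn2l// ltW.
  - by move=> n; exact: ltW.
  - apply/cvgryPge => A; near=> n.
    rewrite /K mulrC ler_pdivlMr ?powR_gt0//; apply: le_trans (Kgrow n).
    rewrite -ler_pdivrMl ?subr_gt0//.
    by near: n; exact: nbhs_infty_ger.
  - move=> n; apply: le_trans (bound n) _; rewrite lee_fin ler_wpM2l ?powR_ge0//.
    rewrite lerD2l ler_wpM2r ?invr_ge0 ?(ltW p1_gt0)//.
    rewrite -[leRHS]mulr1 ler_wpM2l ?subr_ge0 ?(ltW B1)//.
    by rewrite gerBl exprn_ge0// ltW.
move=> /(lee_wpmul2l (_ : (0 <= r%:E)%E)) => /(_ _)/le_trans; apply.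
  by rewrite lee_fin ltW.
rewrite -EFinM lee_fin mulrCA [leRHS]mulrC ler_wpM2l ?powR_ge0//.
(* The factor [r] turns the sum of the series into this quotient, which [p1] bounds by [1 / a]. *)
have -> : r * (1 + (B - 1) / (1 - p)) = (1 - th) / (1 - p).
  by rewrite pB /B; field; rewrite !gt_eqF.
by rewrite ler_pdivrMr// ler_pdivlMl.
Unshelve. all: by end_near. Qed.

End TailPower.

(** * Exchange of integrals over the region [rho x < rho y] *)

Section OrderTonelli.
Context {R : realType} {d : measure_display} {T : measurableType d}.
Variable (mu : {measure set T -> \bar R}).

Section NatFibers.
Variable L : T -> nat.
Hypothesis mL : forall P : nat -> bool, measurable [set x | P (L x)].

Lemma measurable_nat_comp (phi : nat -> \bar R) :
  measurable_fun setT (fun x => phi (L x)).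
Proof.
move=> _ Y _; rewrite setTI.
have := mL (fun n => `[< Y (phi n) >]).
by congr measurable; apply/seteqP; split => x /= /asboolP.
Qed.

Lemma integral_nat_fibers (phi : nat -> \bar R) (F : T -> \bar R) :
  (forall n, 0 <= phi n)%E -> measurable_fun setT F -> (forall x, 0 <= F x)%E ->
  (\int[mu]_x (phi (L x) * F x) =
   \sum_(0 <= j <oo) phi j * \int[mu]_(x in [set x | L x == j]) F x)%E.
Proof.
move=> phi0 mF F0.
have mphi := measurable_nat_comp phi.
have UE : \bigcup_j [set x | L x == j] = setT.
  by apply/seteqP; split => // x _; exists (L x) => /=.
rewrite -[X in integral _ X]UE ge0_integral_bigcup//.
- apply: eq_eseriesr => j _; rewrite -ge0_integralZl//; last 2 first.
    exact: mL (fun n => n == j).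
    exact: measurable_funTS.
  by apply: eq_integral => x; rewrite inE /= => /eqP ->.
- by move=> j; exact: mL (fun n => n == j).
- by rewrite UE; exact: emeasurable_funM.
- by move=> x _; rewrite mule_ge0.
- by apply/trivIsetP => i j _ _ ij; apply/seteqP; split => // x /= [/eqP -> /eqP ji]; rewrite ji eqxx in ij.
Qed.

Lemma integral_nat_pred (P : pred nat) (c : \bar R) (F : T -> \bar R) :
  (0 <= c)%E -> measurable_fun setT F -> (forall x, 0 <= F x)%E ->
  (c * \int[mu]_(x in [set x | P (L x)]) F x =
   \sum_(0 <= j <oo)
      (if P j then c else 0) * \int[mu]_(x in [set x | L x == j]) F x)%E.
Proof.
move=> c0 mF F0.
rewrite -integral_nat_fibers//; last by move=> n; case: ifP.
rewrite -ge0_integralZl//; last exact: measurable_funTS.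
rewrite integral_mkcond; apply: eq_integral => x _.
rewrite patchE; have [Px|Px] := boolP (P (L x)); first by rewrite mem_set.
by rewrite memNset ?mul0e//=; exact/negP.
Qed.

(** Both sides expand into the same double series over pairs of fibers [L = i], [L = j] with the
    order condition, and nonnegative series can be interchanged. Only countably many fibers occur,
    so no finiteness of [mu] enters. *)
Lemma integral_nat_swap (F k : T -> \bar R) :
  measurable_fun setT F -> (forall x, 0 <= F x)%E ->
  measurable_fun setT k -> (forall x, 0 <= k x)%E ->
  (\int[mu]_y (k y * \int[mu]_(x in [set x | L x < L y]%N) F x) =
   \int[mu]_x (F x * \int[mu]_(y in [set y | L x < L y]%N) k y))%E.
Proof.
move=> mF F0 mk k0.
under eq_integral do rewrite muleC.
under [RHS]eq_integral do rewrite muleC.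
rewrite (integral_nat_fibers (fun n => \int[mu]_(x in [set x | L x < n]%N) F x)%E)//;
  last by move=> n; exact: integral_ge0.
rewrite (integral_nat_fibers (fun n => \int[mu]_(x in [set y | n < L y]%N) k x)%E)//;
  last by move=> n; exact: integral_ge0.
under eq_eseriesr => j _.
  rewrite muleC (integral_nat_pred (fun n => n < j)%N)//; last exact: integral_ge0.
  over.
under [RHS]eq_eseriesr => j _.
  rewrite muleC (integral_nat_pred (fun n => j < n)%N)//; last exact: integral_ge0.
  over.
rewrite nneseries_interchange.
  apply: eq_eseriesr => i _; apply: eq_eseriesr => j _.
  by case: ifP; rewrite ?mul0e// muleC.
by move=> i j; rewrite mule_ge0//; [case: ifP => // _|]; exact: integral_ge0.
Qed.

End NatFibers.

(** A separating integer survives doubling: [a < m <= b] gives [2 a < 2 m <= 2 b]. This makes the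
    dyadic approximations of [rho x < rho y] increase. *)
Lemma ltn_truncP (a b : R) : 0 <= a -> 0 <= b ->
  (Num.trunc a < Num.trunc b)%N <-> exists m : nat, a < m%:R <= b.
Proof.
move=> a0 b0; split => [ab|[m /andP[am mb]]].
  by exists (Num.trunc b); rewrite truncn_le b0 andbT -truncn_lt_nat.
by rewrite (@leq_trans m)// ?truncn_lt_nat// truncn_ge_nat.
Qed.

(* Tonelli holds here for an arbitrary measure: [rho x < rho y] is the increasing limit of
   [trunc (2 ^ n rho x) < trunc (2 ^ n rho y)], a countable union of rectangles. *)
Lemma integral_order_swap_le (rho : T -> R) (F k : T -> \bar R) :
  measurable_fun setT rho -> (forall x, 0 <= rho x) ->
  measurable_fun setT F -> (forall x, 0 <= F x)%E ->
  measurable_fun setT k -> (forall x, 0 <= k x)%E ->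
  (\int[mu]_y (k y * \int[mu]_(x in [set x | (rho x < rho y)%R]) F x) <=
   \int[mu]_x (F x * \int[mu]_(y in [set y | (rho x < rho y)%R]) k y))%E.
Proof.
move=> mrho rho0 mF F0 mk k0.
pose L n x := Num.trunc (2 ^+ n * rho x).
have cn0 n x : 0 <= 2 ^+ n * rho x by rewrite mulr_ge0// exprn_ge0.
have mL n (P : nat -> bool) : measurable [set x | P (L n x)].
  rewrite (_ : [set x | P (L n x)] =
      \bigcup_(j in P) (rho @^-1` `[j%:R / 2 ^+ n, j.+1%:R / 2 ^+ n[%classic)).
    apply: bigcup_measurable => j _; rewrite -[X in measurable X]setTI.
    exact: mrho.
  have e2 : 0 < 2 ^+ n :> R by rewrite exprn_gt0.
  apply/seteqP; split => x /=.
    move=> Px; exists (L n x) => //=; rewrite in_itv/= ler_pdivrMr// ltr_pdivlMr//.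
    by rewrite [rho x * _]mulrC truncn_itv.
  move=> [j Pj /=]; rewrite in_itv/= ler_pdivrMr// ltr_pdivlMr// [rho x * _]mulrC.
  by move=> /truncn_def; rewrite -/(L n x) => ->.
have Llt n x y : (L n x < L n y)%N -> rho x < rho y.
  move/(ltn_truncP _ _ (cn0 n x) (cn0 n y)) => [m /andP[h1 h2]].
  by rewrite -(ltr_pM2l (_ : 0 < 2 ^+ n)) ?exprn_gt0//; exact: lt_le_trans h2.
have Lmono m n x y : (m <= n)%N -> (L m x < L m y)%N -> (L n x < L n y)%N.
  move=> mn /(ltn_truncP _ _ (cn0 m x) (cn0 m y)) [i /andP[h1 h2]].
  apply/(ltn_truncP _ _ (cn0 n x) (cn0 n y)); exists (2 ^ (n - m) * i)%N.
  rewrite -(subnK mn) addnK exprD -!mulrA natrM natrX.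
  by rewrite ltr_pM2l ?exprn_gt0// ler_pM2l ?exprn_gt0// h1.
have Lsep x y : rho x < rho y -> exists n, (L n x < L n y)%N.
  move=> xy; pose e := rho y - rho x; have e0 : 0 < e by rewrite subr_gt0.
  have [n en] : exists n, 1 <= 2 ^+ n * e.
    exists (Num.bound e^-1); rewrite -ler_pdivrMr// div1r.
    apply: (@le_trans _ _ (Num.bound e^-1)%:R).
      by rewrite ltW// archi_boundP// invr_ge0 ltW.
    by rewrite -natrX ler_nat ltnW// ltn_expl.
  (* Once the scaled gap is at least 1, the first integer above [2^n * rho x] separates the two
     values. *)
  exists n; apply/(ltn_truncP _ _ (cn0 n x) (cn0 n y)); exists (L n x).+1.
  have /andP[h1 h2] := truncn_itv (cn0 n x).
  rewrite h2 /= -natr1; apply: le_trans (_ : 2 ^+ n * rho x + 1 <= _).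
    by rewrite lerD2r.
  by move: en; rewrite /e mulrBr; lra.
pose S n y := [set x | (L n x < L n y)%N].
have SU y : \bigcup_n S n y = [set x | rho x < rho y].
  apply/seteqP; split => x /=; first by move=> [n _ /= /Llt].
  by move/Lsep => [n ?]; exists n.
have SmU y : measurable [set x | rho x < rho y].
  rewrite -SU; apply: bigcup_measurable => n _; exact: (mL n (fun i => i < L n y)%N).
have mabove c : measurable [set y | c < rho y].
  by apply: (measurable_upset rho) => // u v /=; exact: lt_le_trans.
have mS n y : measurable (S n y) by exact: (mL n (fun i => i < L n y)%N).
pose m n y := (k y * \int[mu]_(x in S n y) F x)%E.
have m0 n y : (0 <= m n y)%E by rewrite mule_ge0// integral_ge0.
have mono y : {homo m^~ y : i j / (i <= j)%N >-> (i <= j)%E}.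
  move=> i j ij; apply: lee_wpmul2l => //; apply: ge0_subset_integral => //.
    exact: measurable_funTS.
  by move=> x /=; exact: Lmono.
have mm n : measurable_fun setT (m n).
  apply: emeasurable_funM => //.
  exact: (measurable_nat_comp (L n) (mL n) (fun i => \int[mu]_(x in [set x | L n x < i]%N) F x)%E).
have cv y : m n y @[n --> \oo] --> (k y * \int[mu]_(x in [set x | (rho x < rho y)%R]) F x)%E.
  rewrite -ge0_integralZl//; last exact: measurable_funTS.
  have -> : m^~ y = (fun n => \int[mu]_(x in S n y) (k y * F x))%E.
    by apply/funext => n; rewrite ge0_integralZl//; exact: measurable_funTS.
  rewrite -SU; apply: ge0_nondecreasing_set_cvg_integral => //.
  - by move=> i j ij; apply/subsetPset => x; exact: Lmono.
  - by move=> i; apply: emeasurable_funM => //; exact: measurable_funTS.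
  - by move=> i x _; rewrite mule_ge0.
rewrite (eq_integral (fun y => limn (m^~ y))); last first.
  by move=> y _; apply/esym/cvg_lim.
rewrite monotone_convergence//.
apply: lime_le.
  apply: ereal_nondecreasing_is_cvgn => i j ij; apply: ge0_le_integral => //.
  by move=> x _; exact: mono.
apply: nearW => n; rewrite integral_nat_swap//.
apply: ge0_le_integral => //.
- by move=> x _; rewrite mule_ge0// integral_ge0.
- apply: emeasurable_funM => //.
  exact: (measurable_nat_comp (L n) (mL n) (fun i => \int[mu]_(x in [set y | i < L n y]%N) k x)%E).
- apply: emeasurable_funM => //; apply: (measurable_along (fun x => - rho x)).
    exact: measurableT_comp.
  move=> x y; rewrite lerN2 => yx; apply: ge0_subset_integral => //.
  + exact: measurable_funTS.
  + by move=> z /=; exact: le_lt_trans.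
- move=> x _; apply: lee_wpmul2l => //; apply: ge0_subset_integral => //.
  + exact: measurable_funTS.
  + by move=> z /=; exact: Llt.
Qed.

End OrderTonelli.

(** * Muckenhoupt's weighted Hardy inequality *)

Section WeightedHardy.
Context {R : realType} {d : measure_display} {T : measurableType d}.
Variables (mu : {measure set T -> \bar R}) (rho : T -> R).
Hypothesis mrho : measurable_fun setT rho.

Lemma measurable_above c : measurable [set y | c < rho y].
Proof. by apply: (measurable_upset rho) => // u v /=; exact: lt_le_trans. Qed.

Lemma measurable_below c : measurable [set y | rho y < c].
Proof.
apply: (measurable_upset (fun x => - rho x)) => [|u v /= uc].
  exact: measurableT_comp.
by rewrite lerN2 => vu; exact: le_lt_trans uc.
Qed.

Definition ball_int (F : T -> \bar R) (y : T) : \bar R :=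
  \int[mu]_(x in [set x | rho x < rho y]) F x.

Lemma ball_int_ge0 F y : (forall x, 0 <= F x)%E -> (0 <= ball_int F y)%E.
Proof. by move=> F0; exact: integral_ge0. Qed.

Lemma measurable_ball_int F : measurable_fun setT F -> (forall x, 0 <= F x)%E ->
  measurable_fun setT (ball_int F).
Proof.
move=> mF F0; apply: (measurable_along rho) => // x y xy.
apply: ge0_subset_integral => //; try exact: measurable_below.
  exact: measurable_funTS.
by move=> z /=; move=> /lt_le_trans; exact.
Qed.

(** The hypothesis is raised to the power [q - 1], and [a * (q - 1) = b]. Once [X = 0] is set aside,
    an infinite [W] or [X] contradicts the finite bound [D]. *)
Lemma le_poweR_mulV (a b q D : R) (W X : \bar R) : 0 < a -> 0 < b -> a + b = 1 ->
  a * q = 1 -> 0 <= D -> (0 < W)%E -> (0 <= X)%E -> (W `^ a * X <= D%:E)%E ->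
  (X `^ (q - 1) <= (D `^ (q - 1))%:E * (W `^ b)^-1)%E.
Proof.
move=> a0 b0 ab aq D0 W0 X0 WX.
have q1 : a * (q - 1) = b by rewrite mulrBr aq mulr1 -ab addrAC subrr add0r.
have q1_gt0 : 0 < q - 1 by rewrite -(pmulr_rgt0 _ a0) q1.
have RHS0 : (0 <= (D `^ (q - 1))%:E * (W `^ b)^-1)%E.
  by rewrite mule_ge0 ?lee_fin ?powR_ge0// inve_ge0 poweR_ge0.
have [->|Xn0] := eqVneq X 0%E; first by rewrite poweR0r ?gt_eqF.
have X_gt0 : (0 < X)%E by rewrite lt0e Xn0.
move: W0 WX RHS0; case: W => [W| |]// W0; last first.
  by rewrite poweRyr ?gt_eqF// gt0_mulye.
move: X0 Xn0 X_gt0; case: X => [X| |]// X0 Xn0 X_gt0 WX _; last first.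
  by move: WX; rewrite gt0_muley ?poweR_gt0// leye_eq.
move: WX; rewrite !poweR_EFin -EFinM !lee_fin => WX.
have Wb : 0 < W `^ b by rewrite powR_gt0.
rewrite inver gt_eqF// -EFinM lee_fin ler_pdivlMr//.
rewrite -q1 powRrM -powRM ?powR_ge0//.
apply: ge0_ler_powR; rewrite ?nnegrE ?mulr_ge0 ?powR_ge0 ?(ltW q1_gt0)//.
by rewrite mulrC.
Qed.

(** Here [a = 1/q], [b = 1/q']. In the constant, [b^-1 ^ (q - 1)] comes from the tail inequality on
    balls and [q = a^-1] from the one on outer regions; [D^(q - 1)] comes from the hypothesis at
    [y], the last [D] from [HV] at [x]. Since [b * q = q - 1], it equals the q-th power of
    [(q')^(1/q') q^(1/q) D]. *)
Lemma weighted_hardy (w sig gam f : T -> \bar R) (q a b D : R) :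
  (forall x, 0 <= rho x) ->
  measurable_fun setT w -> (forall x, 0 <= w x)%E ->
  measurable_fun setT sig -> (forall x, 0 <= sig x)%E ->
  measurable_fun setT gam -> (forall x, 0 <= gam x)%E ->
  measurable_fun setT f -> (forall x, 0 <= f x)%E ->
  0 < a -> 0 < b -> a + b = 1 -> a * q = 1 -> 0 <= D ->
  (forall x, tail mu rho w x `^ a * ball_int sig x `^ b <= D%:E)%E ->
  {ae mu, forall x, (sig x < +oo)%E -> (f x <= gam x * sig x `^ b)%E} ->
  (\int[mu]_y (w y * ball_int f y `^ q) <=
   (b^-1 `^ (q - 1) * q * D `^ q)%:E * \int[mu]_x (gam x `^ q))%E.
Proof.
move=> rho0 mw w0 msig sig0 mgam gam0 mf f0 a0 b0 ab aq D0 HD Hf.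
have q1 : a * (q - 1) = b by rewrite mulrBr aq mulr1 -ab addrAC subrr add0r.
have q1_gt0 : 0 < q - 1 by rewrite -(pmulr_rgt0 _ a0) q1.
have q0 : 0 < q by rewrite -(pmulr_rgt0 _ a0) aq.
have bq : b * q = q - 1.
  by rewrite -q1 mulrAC aq mul1r.
have ba : b + a = 1 by rewrite addrC.
have mNrho : measurable_fun setT (fun x => - rho x) by exact: measurableT_comp.
pose W := tail mu rho w; pose Gb := tail mu (fun x => - rho x) sig.
have W0 x : (0 <= W x)%E by exact: tail_ge0.
have Gb0 x : (0 <= Gb x)%E by exact: tail_ge0.
have mW : measurable_fun setT W by exact: measurable_tail.
have mGb : measurable_fun setT Gb by exact: measurable_tail.
pose k x := (w x * (W x `^ b)^-1)%E.
pose F x := (gam x `^ q * Gb x `^ b)%E.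
have k0 x : (0 <= k x)%E by rewrite mule_ge0// inve_ge0 poweR_ge0.
have F0 x : (0 <= F x)%E by rewrite mule_ge0// poweR_ge0.
have mk : measurable_fun setT k.
  apply: emeasurable_funM => //; apply: measurable_inve => [|x]; last exact: poweR_ge0.
  exact: measurable_poweR_fun.
have mF : measurable_fun setT F.
  by apply: emeasurable_funM; exact: measurable_poweR_fun.
pose V x := (\int[mu]_(y in [set y | (rho x < rho y)%R]) w y)%E.
have V0 x : (0 <= V x)%E by exact: integral_ge0.
(* The hypothesis pairs a closed tail with an open ball, while [HV] pairs the closed ball with the
   open tail. For [rho x < rho y] the closed ball of [x] lies in the open ball of [y]; the bound on
   the tails of all such [y] passes to [V x] by [integral_upset_le]. *)
have HV x : (Gb x `^ b * V x `^ a <= D%:E)%E.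
  have HWG y : rho x < rho y -> (W y `^ a * Gb x `^ b <= D%:E)%E.
    move=> xy; apply: le_trans (HD y); apply: lee_wpmul2l; first exact: poweR_ge0.
    apply: le_poweR => //; first exact: ltW.
    apply: ge0_subset_integral => //.
    - apply: (measurable_upset (fun x => - rho x)) => // u v /=; exact: le_trans.
    - exact: measurable_below.
    - exact: measurable_funTS.
    - by move=> z /=; rewrite lerN2 => /le_lt_trans; exact.
  have upU : upset rho [set y | rho x < rho y] by move=> u v /=; exact: lt_le_trans.
  have [G00|Gn0] := eqVneq (Gb x `^ b)%E 0%E; first by rewrite G00 mul0e lee_fin.
  have [Gy|Gny] := eqVneq (Gb x `^ b)%E +oo%E.
    have V00 : (V x <= 0)%E.
      apply: (integral_upset_le mu rho) => // y /= xy.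
      have := HWG y xy; rewrite Gy leNgt => /negP WD; rewrite leNgt; apply/negP => Wy.
      by apply: WD; rewrite gt0_muley ?ltry// poweR_gt0.
    have -> : V x = 0%E by apply/eqP; rewrite eq_le V00 V0.
    by rewrite poweR0r ?gt_eqF// mule0 lee_fin.
  have [g gE] : exists g, (Gb x `^ b)%E = g%:E.
    by exists (fine (Gb x `^ b)%E); rewrite fineK// ge0_fin_numE ?poweR_ge0// ltey.
  have g0 : 0 < g by rewrite -lte_fin -gE lt0e Gn0 poweR_ge0.
  have VD : (V x <= ((D / g) `^ q)%:E)%E.
    apply: (integral_upset_le mu rho) => //; first by rewrite lee_fin powR_ge0.
    move=> y /= xy; have := HWG y xy; rewrite gE muleC -lee_pdivlMl// => Wle.
    have -> : tail mu rho w y = ((W y `^ a) `^ q)%E by rewrite -poweRrM aq poweRe1.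
    rewrite -poweR_EFin; apply: le_poweR; [exact: ltW|exact: poweR_ge0|].
    by rewrite mulrC EFinM.
  rewrite gE -lee_pdivlMl// -EFinM mulrC.
  have -> : (D / g)%:E = (((D / g) `^ q)%:E `^ a)%E.
    by rewrite poweR_EFin -powRrM [q * a]mulrC aq powRr1// divr_ge0// ltW.
  by apply: le_poweR => //; exact: ltW.
(* Where [W] vanishes, the weight [(W^b)^-1] is [+oo]. The set of these points is an upset of zero
   [w]-mass, so [w] is null almost everywhere on it. *)
have Wnull : {ae mu, forall y, W y = 0%E -> w y = 0%E}.
  have mZ : measurable [set y | (W y <= 0)%E].
    by rewrite -[X in measurable X]setTI; exact: emeasurable_fun_infty_c.
  have : (\int[mu]_(y in [set y | W y <= 0]) w y <= 0)%E.
    apply: (integral_upset_le mu rho) => // u v /= Wu uv; apply: le_trans Wu.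
    apply: ge0_subset_integral => //.
    - by apply: (measurable_upset rho) => // x y /=; exact: le_trans.
    - by apply: (measurable_upset rho) => // x y /=; exact: le_trans.
    - exact: measurable_funTS.
    - by move=> z /=; exact: le_trans.
  move=> w00; have /ae_eq_integral_abs : (\int[mu]_(y in [set y | W y <= 0]) `|w y| = 0)%E.
    under eq_integral do rewrite gee0_abs//.
    by apply/eqP; rewrite eq_le w00 integral_ge0.
  move=> /(_ mZ (measurable_funTS mw)); apply: filterS => y Hy Wy.
  by rewrite Hy//= Wy.
pose c := (b^-1 `^ (q - 1) * D `^ (q - 1)).
have c0 : 0 <= c by rewrite mulr_ge0// powR_ge0.
have pointwise : {ae mu, forall y,
    (w y * ball_int f y `^ q <= c%:E * (k y * ball_int F y))%E}.
  apply: filterS Wnull => y Wy.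
  have [->|wy] := eqVneq (w y) 0%E.
    by rewrite mul0e mule_ge0 ?lee_fin// mule_ge0// ball_int_ge0.
  have Wy_gt0 : (0 < W y)%E.
    by rewrite lt0e W0 andbT; apply: contra_neq wy.
  have Gy : (ball_int sig y < +oo)%E.
    rewrite ltey; apply/eqP => Gy; have := HD y.
    by rewrite Gy poweRyr ?gt_eqF// gt0_muley// poweR_gt0.
  (* Muckenhoupt's factorisation: [gam * sig^b] equals [F^a * Q^b], since the powers [Gb^(a b)] and
     [Gb^(- a b)] cancel. *)
  pose Q x := (sig x * (Gb x `^ a)^-1)%E.
  have Q0 x : (0 <= Q x)%E by rewrite mule_ge0// inve_ge0 poweR_ge0.
  have mQ : measurable_fun setT Q.
    apply: emeasurable_funM => //; apply: measurable_inve => [|x]; last exact: poweR_ge0.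
    exact: measurable_poweR_fun.
  have QG : (ball_int Q y <= (b^-1)%:E * ball_int sig y `^ b)%E.
    apply: integral_tail_poweRV => // u v /= uy; rewrite lerN2 => vu.
    exact: le_lt_trans uy.
  have hol : (ball_int f y <= ball_int F y `^ a * ball_int Q y `^ b)%E.
    apply: hoelder_ae => //; first exact: measurable_below.
      by apply: le_lt_trans QG _; rewrite lte_mul_pinfty ?lee_fin ?invr_ge0 ?(ltW b0)// poweR_lty.
    apply: filterS Hf => x Hx xy Qx.
    have Gbx : (Gb x < +oo)%E.
      apply: le_lt_trans Gy; apply: ge0_subset_integral => //.
      - apply: (measurable_upset (fun x => - rho x)) => // u v /=; exact: le_trans.
      - exact: measurable_below.
      - exact: measurable_funTS.
      - by move=> z /=; rewrite lerN2 => /le_lt_trans; exact.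
    have [G0|Gn0] := eqVneq (Gb x) 0%E.
      have s0 : sig x = 0%E.
        apply/eqP; move: Qx; apply: contraLR => sn0.
        by rewrite /Q G0 poweR0r ?gt_eqF// inve0 gt0_muley// lt0e sn0 sig0.
      by apply: le_trans (Hx _) _; rewrite s0 ?ltry// poweR0r ?gt_eqF// mule0 mule_ge0 ?poweR_ge0.
    have [g gE] : exists g, Gb x = g%:E.
      by exists (fine (Gb x)); rewrite fineK// ge0_fin_numE.
    have g0 : 0 < g by rewrite -lte_fin -gE lt0e Gn0 Gb0.
    have sx : (sig x < +oo)%E.
      rewrite ltey; apply/eqP => sy; move: Qx.
      rewrite /Q sy gE poweR_EFin inver gt_eqF ?powR_gt0// gt0_mulye ?ltxx//.
      by rewrite lte_fin invr_gt0 powR_gt0.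
    apply: le_trans (Hx sx) _.
    rewrite /F /Q gE !poweR_EFin inver gt_eqF ?powR_gt0//.
    rewrite !poweRM ?poweR_ge0 ?lee_fin ?invr_ge0 ?powR_ge0//.
    rewrite -poweRrM [q * a]mulrC aq poweRe1// muleACA !poweR_EFin -EFinM.
    rewrite -[(g `^ a)^-1]powRN -!powRrM mulNr [b * a]mulrC powRN mulfV ?mule1//.
    by rewrite gt_eqF// powR_gt0.
  have Fq : ((ball_int F y `^ a) `^ q = ball_int F y)%E.
    by rewrite -poweRrM aq poweRe1// ball_int_ge0.
  have holq : (ball_int f y `^ q <=
      (b^-1 `^ (q - 1))%:E * ball_int F y * (ball_int sig y `^ b) `^ (q - 1))%E.
    apply: le_trans (le_poweR _ _ _ (ltW q0) _ hol) _; first exact: ball_int_ge0.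
    rewrite poweRM ?poweR_ge0// Fq -[X in (_ * X <= _)%E]poweRrM bq.
    rewrite [((_)%:E * _)%E]muleC -muleA; apply: lee_wpmul2l; first exact: ball_int_ge0.
    rewrite -poweR_EFin -poweRM ?lee_fin ?invr_ge0 ?(ltW b0) ?poweR_ge0//.
    apply: le_poweR => //; [exact: ltW|exact: ball_int_ge0].
  have := le_poweR_mulV a b q D (W y) (ball_int sig y `^ b)%E a0 b0 ab aq D0 Wy_gt0 (poweR_ge0 _ _) (HD y).
  move=> GD.
  apply: (@le_trans _ _ (w y * ((b^-1 `^ (q - 1))%:E * ball_int F y *
     ((D `^ (q - 1))%:E * (W y `^ b)^-1)))%E).
    apply: lee_wpmul2l => //; apply: le_trans holq _; apply: lee_wpmul2l => //.
    by rewrite mule_ge0 ?lee_fin ?powR_ge0// ball_int_ge0.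
  by rewrite muleACA (muleCA (w y)) (muleC (ball_int F y)) (muleA (w y)) /c EFinM lexx.
have swap := integral_order_swap_le mu rho F k mrho rho0 mF F0 mk k0.
have mbF := measurable_ball_int F mF F0.
apply: (@le_trans _ _ (\int[mu]_y (c%:E * (k y * ball_int F y)))%E).
  apply: ae_ge0_le_integral => //.
  - by move=> y _; rewrite mule_ge0// poweR_ge0.
  - apply: emeasurable_funM => //; apply: measurable_poweR_fun.
    exact: measurable_ball_int.
  - by move=> y _; rewrite mule_ge0 ?lee_fin// mule_ge0// ball_int_ge0.
  - by do 2 apply: emeasurable_funM => //.
  - by apply: filterS pointwise => y Hy _.
rewrite ge0_integralZl ?lee_fin//; last 2 first.
  exact: emeasurable_funM.
  by move=> y _; rewrite mule_ge0// ball_int_ge0.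
apply: (@le_trans _ _ (c%:E * \int[mu]_x ((q * D)%:E * gam x `^ q))%E).
  apply: lee_wpmul2l; first by rewrite lee_fin.
  apply: le_trans swap _; apply: ge0_le_integral => //.
  - by move=> x _; rewrite mule_ge0// integral_ge0.
  - apply: emeasurable_funM => //; apply: (measurable_along (fun x => - rho x)) => //.
    move=> x y; rewrite lerN2 => yx; apply: ge0_subset_integral => //; try exact: measurable_above.
      exact: measurable_funTS.
    by move=> z /=; exact: le_lt_trans.
  - by apply: emeasurable_funM => //; exact: measurable_poweR_fun.
  move=> x _.
  have kV : (\int[mu]_(y in [set y | (rho x < rho y)%R]) k y <= (a^-1)%:E * V x `^ a)%E.
    by apply: integral_tail_poweRV => // u v /=; exact: lt_le_trans.
  apply: le_trans (lee_wpmul2l (F0 x) kV) _.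
  have -> : a^-1 = q by rewrite -[LHS]mulr1 -aq mulKf// gt_eqF.
  rewrite /F muleACA muleC.
  apply: le_trans (lee_wpmul2r _ (HV x)) _.
    by rewrite mule_ge0 ?poweR_ge0// lee_fin ltW.
  by rewrite [(gam x `^ q * _)%E]muleC muleA -EFinM [D * q]mulrC.
rewrite ge0_integralZl//; last 3 first.
- exact: measurable_poweR_fun.
- by move=> x _; exact: poweR_ge0.
- by rewrite lee_fin mulr_ge0// ltW.
rewrite muleA -EFinM /c mulrACA [D `^ (q - 1) * D](_ : _ = D `^ q)//.
have [->|Dn0] := eqVneq D 0; first by rewrite mulr0 powR0// gt_eqF.
by rewrite -[X in _ * X]powRr1// -powRD ?subrK// gt_eqF.
Qed.

End WeightedHardy.

(** This is convexity of the q-th power at [(1 - k) * (x / (1 - k)) + k * (y / k)], obtained from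
    the two-term Hoelder inequality. *)
Lemma poweRD_le_split {R : realType} (k q : R) (x y : \bar R) : 0 < k -> k < 1 -> 1 < q ->
  (0 <= x)%E -> (0 <= y)%E ->
  ((x + y) `^ q <= ((1 - k) `^ (1 - q))%:E * x `^ q + (k `^ (1 - q))%:E * y `^ q)%E.
Proof.
move=> k0 k1 q1; have q0 : 0 < q by exact: lt_trans q1.
have k1' : 0 < 1 - k by rewrite subr_gt0.
have inf (c : R) (t : \bar R) : 0 < c -> (0 <= t)%E ->
    (c%:E * +oo%E + t = +oo)%E.
  by move=> c0 t0; rewrite gt0_muley ?lte_fin// addye// gt_eqF// (lt_le_trans _ t0).
case: x => [x| |]// x0; last first.
  rewrite poweRyr ?gt_eqF// inf ?leey ?powR_gt0//.
  by rewrite mule_ge0 ?poweR_ge0// lee_fin powR_ge0.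
case: y => [y| |]// y0; last first.
  rewrite poweRyr ?gt_eqF// [leRHS]addeC inf ?leey ?powR_gt0//.
  by rewrite mule_ge0 ?poweR_ge0// lee_fin powR_ge0.
suff : (x + y) `^ q <= (1 - k) `^ (1 - q) * x `^ q + k `^ (1 - q) * y `^ q by [].
rewrite !lee_fin in x0 y0.
pose b := (q - 1) / q.
have b0 : 0 < b by rewrite divr_gt0// subr_gt0.
have := @hoelder2 R (x * (1 - k) `^ (- b)) (y * k `^ (- b)) ((1 - k) `^ b) (k `^ b)
  q b^-1.
rewrite !mulr_ge0 ?powR_ge0// invr_gt0 invrK.
have -> : q^-1 + b = 1 by rewrite /b; field; rewrite gt_eqF.
move=> /(_ isT isT isT isT q0 b0 erefl).
rewrite -!mulrA !powRN !mulVf ?gt_eqF ?powR_gt0// !mulr1.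
rewrite -!powRrM !mulfV ?gt_eqF// !powRr1 ?(ltW k1') ?(ltW k0)// subrK powR1 mulr1.
rewrite -!powRN !powRM ?powR_ge0// -!powRrM.
have -> : - b * q = 1 - q by rewrite /b; field; rewrite gt_eqF.
move=> H.
have xy0 : 0 <= x + y by rewrite addr_ge0.
have := @ge0_ler_powR R q (ltW q0) _ _ _ _ H; rewrite !nnegrE xy0 powR_ge0.
move=> /(_ isT isT) /le_trans; apply.
rewrite -powRrM mulVf ?gt_eqF// powRr1 ?addr_ge0 ?mulr_ge0 ?powR_ge0//.
by rewrite mulrC [k `^ _ * _]mulrC.
Qed.

(** The exponents [a = (q - 2)/(q - 1)] and [b = 1/(q - 1)] solve [a + b = 1], [a + q * b = 2], so
    [|g|^2] is [|g|^a] times [(|g|^q)^b]. Raising Hoelder to the power [2 - 2/q] gives the exponents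
    of the theorem. *)
Lemma enorm_interpolation {R : realType} {d} {T : measurableType d}
    (mu : {measure set T -> \bar R}) (q : R) (g : T -> \bar R) : 2 < q ->
  measurable_fun setT g -> (\int[mu]_x (`|g x| `^ q) < +oo)%E ->
  (enorm mu 2 g `^ (4 - 4 / q) <=
   (\int[mu]_x (`|g x| `^ q)) `^ (2 / q) * enorm mu 1 g `^ (2 * (q - 2) / q))%E.
Proof.
move=> q2 mg gq; have q0 : 0 < q by exact: lt_trans q2.
have q1 : 0 < q - 1 by move: q2; lra.
have q20 : 0 < q - 2 by rewrite subr_gt0.
have mag : measurable_fun setT (fun x => `|g x|%E) by exact: measurableT_comp.
pose a := (q - 2) / (q - 1); pose b := (q - 1)^-1.
have a0 : 0 < a by exact: divr_gt0.
have b0 : 0 < b by rewrite invr_gt0.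
have H : (\int[mu]_x (`|g x| `^ 2) <=
    (\int[mu]_x `|g x|) `^ a * (\int[mu]_x (`|g x| `^ q)) `^ b)%E.
  apply: hoelder_ae => //.
  - exact: measurable_poweR_fun.
  - exact: measurable_poweR_fun.
  - by move=> x; exact: poweR_ge0.
  - by move=> x; exact: poweR_ge0.
  - by rewrite /a /b; field; rewrite gt_eqF.
  apply: aeW => x _ _.
  have e2 : a + q * b = 2 by rewrite /a /b; field; rewrite gt_eqF.
  by rewrite -poweRrM -poweRD ?e2// add_neq0_poweRD_def// e2.
rewrite /enorm invr1 -poweRrM poweRe1; last by apply: integral_ge0 => x _; exact: poweR_ge0.
have -> : (\int[mu]_x (`|g x| `^ 1) = \int[mu]_x `|g x|)%E.
  by apply: eq_integral => x _; rewrite poweRe1.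
have t0 : 0 <= 2^-1 * (4 - 4 / q) :> R.
  have -> : 2^-1 * (4 - 4 / q) = 2 * (q - 1) / q by field; rewrite gt_eqF.
  by rewrite divr_ge0 ?mulr_ge0// ltW.
apply: le_trans (le_poweR _ _ _ t0 _ H) _.
  by apply: integral_ge0 => x _; exact: poweR_ge0.
rewrite poweRM ?poweR_ge0// -!poweRrM muleC.
have -> : b * (2^-1 * (4 - 4 / q)) = 2 / q.
  by rewrite /b; field; rewrite !gt_eqF.
have -> : a * (2^-1 * (4 - 4 / q)) = 2 * (q - 2) / q.
  by rewrite /a; field; rewrite !gt_eqF.
by [].
Qed.

(* The inner integral of the energy need not be measurable in y: the distance is
   not assumed to be jointly measurable. *)
Lemma ge0_le_integral_nonmeas {R : realType} {d} {T : measurableType d}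
    (mu : {measure set T -> \bar R}) (f g : T -> \bar R) :
  (forall x, 0 <= f x)%E -> (forall x, f x <= g x)%E ->
  (\int[mu]_x f x <= \int[mu]_x g x)%E.
Proof.
move=> f0 fg; have g0 x : (0 <= g x)%E by exact: le_trans (fg x).
rewrite !ge0_integralTE//; apply: le_ereal_sup => _ [h hf <-].
by exists h => // x; exact: le_trans (fg x).
Qed.

(** * From the Hardy inequality to the lower bound of the energy *)

Section EnergyBound.
Context {R : realType} {d : measure_display} {T : measurableType d}.
Variables (mu : {measure set T -> \bar R}) (dist : T -> T -> R) (a : T).
Variables (s q : R) (v z : T -> R).
Hypotheses (metric : is_metric dist) (borel : borel_sets_measurable dist).
Hypotheses (s0 : 0 < s) (q2 : 2 < q).
Hypotheses (v0 : forall x, 0 <= v x) (z0 : forall x, 0 <= z x).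
Hypotheses (mv : measurable_fun setT v) (mz : measurable_fun setT z).

Let rho := dist a.
Let B x := mu [set y | rho y < rho x].
Let V := ball_int mu rho (fun y => (v y)%:E).
Let Idens y : \bar R := ((v y ^+ 2)%:E * ((z y)%:E)^-1)%E.
Let I := ball_int mu rho Idens.
Let A := Afun mu dist a q v z.
(** [w] and [sig] are the integrands of the two factors of [D1_at]: the outer weight and the dual
    weight of the Hardy inequality. *)
Let w y := (A y * ((rho y `^ (s * q))%:E * V y `^ q)^-1)%E.
Let sig y := (((A y * ((v y `^ q)%:E)^-1 * ((rho y `^ (s * q))%:E)^-1)
  `^ (qconj q - 1))^-1)%E.

Let q0 : 0 < q. Proof. by apply: lt_trans q2. Qed.
Let q1 : 0 < q - 1. Proof. by move: q2; lra. Qed.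

Lemma dist_ge0 x y : 0 <= dist x y. Proof. by case: metric. Qed.
Lemma dist_sym x y : dist x y = dist y x. Proof. by case: metric => _ [_ []]. Qed.
Lemma dist_triangle x y t : dist x t <= dist x y + dist y t.
Proof. by case: metric => _ [_ []]. Qed.

Lemma mballE r : mball dist a r = [set y | rho y < r].
Proof. by apply/seteqP; split => y; rewrite /mball /rho /= dist_sym. Qed.

Lemma BxE x : Bx dist a x = [set y | rho y < rho x].
Proof. exact: mballE. Qed.

Lemma VfunE x : Vfun mu dist a v x = V x.
Proof. by rewrite /Vfun BxE. Qed.

Lemma AfunE x : A x = ((B x `^ (q / 2))^-1 * (I x `^ (q / 2))^-1 * V x `^ q
  * (v x)%:E)%E.
Proof. by rewrite /A /Afun VfunE /Ifun BxE. Qed.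

Lemma measurable_rho : measurable_fun setT rho.
Proof.
apply: (measurability _ (RGenOInfty.measurableE R)) => //.
move=> _ [_ [r ->] <-]; rewrite setTI -[X in measurable X]setCK.
apply: measurableC; rewrite (_ : ~` _ = ~` [set y | r < rho y]); last first.
  by congr (~` _); apply/seteqP; split => y /=; rewrite in_itv/= andbT.
apply: measurableC; apply: borel => x /= rx.
exists (rho x - r); split; first by rewrite subr_gt0.
move=> y; rewrite /mball /= => xy; have := dist_triangle a y x.
by rewrite -/(rho x) -/(rho y); lra.
Qed.

Lemma measurable_B : measurable_fun setT B.
Proof.
apply: (measurable_along rho); first exact: measurable_rho.
move=> x y xy; apply: le_measure; rewrite ?inE; try exact: (measurable_below rho measurable_rho).
by move=> t /= /lt_le_trans; exact.
Qed.

Lemma measurable_Idens : measurable_fun setT Idens.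
Proof.
apply: emeasurable_funM; first by apply/measurable_EFinP; exact: measurable_funX.
by apply: measurable_inve => [|x]; [exact/measurable_EFinP|rewrite lee_fin].
Qed.

Lemma Idens_ge0 y : (0 <= Idens y)%E.
Proof. by rewrite mule_ge0 ?lee_fin ?sqr_ge0// inve_ge0 lee_fin. Qed.

Lemma V_ge0 y : (0 <= V y)%E.
Proof. by apply: ball_int_ge0 => x; rewrite lee_fin. Qed.

Lemma I_ge0 y : (0 <= I y)%E.
Proof. by apply: ball_int_ge0; exact: Idens_ge0. Qed.

Lemma measurable_V : measurable_fun setT V.
Proof.
apply: measurable_ball_int; [exact: measurable_rho|exact/measurable_EFinP|].
by move=> x; rewrite lee_fin.
Qed.

Lemma measurable_A : measurable_fun setT A.
Proof.
have -> : A = (fun x => (B x `^ (q / 2))^-1 * (I x `^ (q / 2))^-1 * V x `^ q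
  * (v x)%:E)%E by apply/funext => x; exact: AfunE.
have mI : measurable_fun setT I.
  apply: measurable_ball_int; [exact: measurable_rho|exact: measurable_Idens|].
  exact: Idens_ge0.
apply: emeasurable_funM; last exact/measurable_EFinP.
apply: emeasurable_funM; last by apply: measurable_poweR_fun; exact: measurable_V.
apply: emeasurable_funM; apply: measurable_inve => [|x].
- by apply: measurable_poweR_fun; exact: measurable_B.
- exact: poweR_ge0.
- exact: measurable_poweR_fun.
- exact: poweR_ge0.
Qed.

Lemma A_ge0 x : (0 <= A x)%E.
Proof. by rewrite AfunE !mule_ge0 ?inve_ge0 ?poweR_ge0// lee_fin. Qed.

Lemma measurable_rho_pow r : measurable_fun setT (fun y => (rho y `^ r)%:E).
Proof.
by apply/measurable_EFinP; exact: (measurableT_comp (measurable_powR r) measurable_rho).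
Qed.

Lemma w_ge0 y : (0 <= w y)%E.
Proof.
by rewrite mule_ge0 ?A_ge0// inve_ge0 mule_ge0 ?poweR_ge0// lee_fin powR_ge0.
Qed.

Lemma measurable_w : measurable_fun setT w.
Proof.
apply: emeasurable_funM; first exact: measurable_A.
apply: measurable_inve => [|y].
  apply: emeasurable_funM; first exact: measurable_rho_pow.
  by apply: measurable_poweR_fun; exact: measurable_V.
by rewrite mule_ge0 ?poweR_ge0// lee_fin powR_ge0.
Qed.

Lemma sig_ge0 y : (0 <= sig y)%E.
Proof. by rewrite inve_ge0 poweR_ge0. Qed.

Lemma measurable_sig : measurable_fun setT sig.
Proof.
apply: measurable_inve => [|y]; last exact: poweR_ge0.
apply: measurable_poweR_fun; apply: emeasurable_funM; last first.
  by apply: measurable_inve => [|y]; [exact: measurable_rho_pow|rewrite lee_fin powR_ge0].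
apply: emeasurable_funM; first exact: measurable_A.
apply: measurable_inve => [|y]; last by rewrite lee_fin powR_ge0.
by apply/measurable_EFinP; exact: (measurableT_comp (measurable_powR q) mv).
Qed.

Lemma D1_atE x : D1_at mu dist a s q v z x =
  (tail mu rho w x `^ q^-1 * ball_int mu rho sig x `^ (qconj q)^-1)%E.
Proof.
rewrite /D1_at BxE.
have -> : ~` [set y | rho y < rho x] = [set y | rho x <= rho y].
  by apply/seteqP; split => y /=; rewrite leNgt => /negP.
rewrite (eq_integral w) => [|y _]; last by rewrite VfunE.
exact: erefl.
Qed.

Lemma A_neq0 y : A y != 0%E -> [/\ 0 < v y, 0 < rho y, B y != +oo%E,
  I y != +oo%E & V y != 0%E].
Proof.
move=> An0; have Vn0 : V y != 0%E.
  by apply: contra_neq An0 => V0; rewrite AfunE V0 poweR0r ?gt_eqF// mule0 mul0e.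
have h2 : 0 < q / 2 by rewrite divr_gt0.
split => //.
- rewrite lt0r v0 andbT; apply: contra_neq An0 => vy.
  by rewrite AfunE vy mule0.
- rewrite lt0r dist_ge0 andbT; apply: contra_neq Vn0 => ry.
  rewrite /V /ball_int ry (_ : [set x | rho x < 0] = set0) ?integral_set0//.
  by apply/seteqP; split => x //=; rewrite ltNge dist_ge0.
- apply: contra_neq An0 => By.
  by rewrite AfunE By poweRyr ?gt_eqF// invey !mul0e.
- apply: contra_neq An0 => Iy.
  by rewrite AfunE Iy poweRyr ?gt_eqF// invey mule0 !mul0e.
Qed.


(** A zero or infinite factor would force the whole product to be 0 or [+oo] under the conventions
    of [\bar R]. From here on, the computation at [y] is one with positive reals. *)
Lemma A_fin_numP y al : A y = al%:E -> 0 < al -> exists be io nu : R,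
  [/\ B y = be%:E, I y = io%:E, V y = nu%:E, [/\ 0 < be, 0 < io, 0 < nu & 0 < v y] &
   0 < rho y /\
   al = (be `^ (q / 2))^-1 * (io `^ (q / 2))^-1 * nu `^ q * v y].
Proof.
move=> Ay al0.
have [vy ry By Iy Vy] : [/\ 0 < v y, 0 < rho y, B y != +oo%E, I y != +oo%E & V y != 0%E].
  by apply: A_neq0; rewrite Ay eqe gt_eqF.
have h2 : 0 < q / 2 by rewrite divr_gt0.
have pinv (x : \bar R) : (0 <= x)%E -> x != +oo%E -> (0 < (x `^ (q / 2))^-1)%E.
  move=> x0 xy; rewrite lt0e inve_ge0 poweR_ge0 andbT inve_eq0.
  by apply: contra xy => /eqP /poweR_eqy ->.
have B0 : (0 <= B y)%E by [].
have [I0 V0] := (I_ge0 y, V_ge0 y).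
move: Ay; rewrite AfunE; have := pinv _ B0 By; have := pinv _ I0 Iy.
have Vq : (0 < V y `^ q)%E by rewrite poweR_gt0// lt0e Vy.
move=> pI pB Ay.
have Bn0 : B y != 0%E.
  apply/eqP => B00; move: Ay; rewrite B00 poweR0r ?gt_eqF// inve0.
  by rewrite !gt0_mulye ?lte_fin.
have In0 : I y != 0%E.
  apply/eqP => I00; move: Ay; rewrite I00 poweR0r ?gt_eqF// inve0.
  by rewrite gt0_muley// !gt0_mulye ?lte_fin.
have Vny : V y != +oo%E.
  apply/eqP => Voo; move: Ay; rewrite Voo poweRyr ?gt_eqF//.
  by rewrite gt0_muley ?mule_gt0// gt0_mulye ?lte_fin.
exists (fine (B y)), (fine (I y)), (fine (V y)).
have [Bf If Vf] : [/\ B y \is a fin_num, I y \is a fin_num & V y \is a fin_num].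
  by split; rewrite ge0_fin_numE// ltey.
have fpos (x : \bar R) : x \is a fin_num -> (0 <= x)%E -> x != 0%E -> 0 < fine x.
  by move=> xf x0 xn; rewrite fine_gt0// lt0e xn x0/= ltey_eq xf.
rewrite !fineK//; split => //; first by split => //; exact: fpos.
split => //; apply: EFin_inj; rewrite -Ay -{1}(fineK Bf) -{1}(fineK If) -{1}(fineK Vf).
by rewrite !poweR_EFin !inver !gt_eqF ?powR_gt0 ?fpos.
Qed.

(** Writing positive bases as exponentials turns the power identities below into identities between
    exponents, which [field] decides. *)
Lemma powR_expR (x t : R) : expR x `^ t = expR (t * x).
Proof. by rewrite /powR gt_eqF ?expR_gt0// expRK. Qed.

Lemma qconj_pos : 0 < qconj q. Proof. exact: divr_gt0. Qed.

Lemma exp_identity_sig (al r vy : R) : 0 < al -> 0 < r -> 0 < vy ->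
  al `^ q^-1 * (r `^ s)^-1 *
    (((al * (vy `^ q)^-1 * (r `^ (s * q))^-1) `^ (qconj q - 1))^-1) `^ (qconj q)^-1
  = vy.
Proof.
move=> al0 r0 vy0.
rewrite -(lnK al0) -(lnK r0) -(lnK vy0) !powR_expR -!expRN -!expRD !powR_expR -!expRN.
rewrite powR_expR -expRD; congr expR; rewrite /qconj; field.
by rewrite !gt_eqF.
Qed.

(** The shape of [A] comes from this identity. Its factor [I^(-q/2)] cancels the Cauchy-Schwarz
    constant, [|B|^(-q/2)] is the ball measure in the kernel, [V^q] cancels the normalisation in
    [w], and [v] is the outer weight of the energy. The application takes [t = 2], from
    [d(x, y) < 2 rho y]. *)
Lemma exp_identity_energy (t be io nu vy r : R) :
  0 < t -> 0 < be -> 0 < io -> 0 < nu -> 0 < vy -> 0 < r ->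
  ((be `^ (q / 2))^-1 * (io `^ (q / 2))^-1 * nu `^ q * vy) *
    (r `^ (s * q) * nu `^ q)^-1 * io `^ (q / 2) =
  t `^ (s * q) * ((((t * r) `^ (2 * s) * be)^-1) `^ (q / 2) * vy).
Proof.
move=> t0 be0 io0 nu0 vy0 r0.
rewrite -(lnK be0) -(lnK io0) -(lnK nu0) -(lnK r0) -(lnK vy0) -(lnK t0).
rewrite -!expRD !powR_expR -!expRN -!expRD -!expRN powR_expR -!expRD.
by congr expR; field.
Qed.

Lemma exp_identity_root (nu r : R) : 0 < nu -> 0 < r ->
  ((r `^ (s * q) * nu `^ q)^-1) `^ q^-1 = (r `^ s)^-1 * nu^-1.
Proof.
move=> nu0 r0; rewrite -(lnK nu0) -(lnK r0) !powR_expR -expRD -!expRN -expRD powR_expR.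
by congr expR; field; rewrite gt_eqF.
Qed.

Section TestFunction.
Variable u : T -> R.
Hypothesis meas_u : measurable_fun setT u.

Let gam y := `|gfun mu dist a s q v z u y|%E.
Let f y : \bar R := (`|u y| * v y)%:E.
Let e y := ((\int[mu]_x (((u x - u y) ^+ 2 * z x)%:E *
        ((dist x y `^ (2 * s))%:E * mu (mball dist a (dist x y / 2)))^-1))
      `^ (q / 2) * (v y)%:E)%E.

Lemma gamE y al : A y = al%:E -> 0 < rho y ->
  gam y = (al `^ q^-1 * (rho y `^ s)^-1 * `|u y|)%:E.
Proof.
move=> Ay ry; rewrite /gam /gfun -/A Ay -/(rho y) poweR_EFin inver gt_eqF ?powR_gt0//.
rewrite -!EFinM abse_EFin !normrM ger0_norm ?powR_ge0//.
by rewrite (ger0_norm (_ : 0 <= _^-1)) ?invr_ge0 ?powR_ge0//; congr EFin; ring.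
Qed.

Lemma gam_A_fin y : (gam y < +oo)%E -> A y != 0%E -> u y != 0 ->
  exists2 al, A y = al%:E & 0 < al.
Proof.
move=> gy An0 uy.
have [_ ry _ _ _] := A_neq0 _ An0.
have Any : A y != +oo%E.
  apply/eqP => Ay; move: gy; rewrite /gam /gfun -/A Ay -/(rho y).
  rewrite poweRyr ?invr_eq0 ?gt_eqF// inver gt_eqF ?powR_gt0// -EFinM abseM/=.
  by rewrite gt0_mulye ?ltxx// lte_fin normr_gt0 mulf_neq0// invr_eq0 gt_eqF// powR_gt0.
exists (fine (A y)); first by rewrite fineK// ge0_fin_numE ?A_ge0// ltey.
by rewrite fine_gt0// lt0e An0 A_ge0 ltey Any.
Qed.

(** The dual weight is built so that equality holds when [A y] is positive and finite. If [u y] is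
    nonzero, finite [sig y] rules out [A y = 0], and finite [gam y] rules out [A y = +oo]. *)
Lemma f_le_gam_sig y : (sig y < +oo)%E -> (gam y < +oo)%E ->
  (f y <= gam y * sig y `^ (qconj q)^-1)%E.
Proof.
move=> sy gy; have [uy|uy] := eqVneq (u y) 0.
  by rewrite /f uy normr0 mul0r mule_ge0 ?poweR_ge0 ?abse_ge0.
have An0 : A y != 0%E.
  apply/eqP => Ay; move: sy; rewrite /sig Ay !mul0e poweR0r ?inve0 ?ltxx//.
  have -> : qconj q - 1 = (q - 1)^-1 by rewrite /qconj; field; rewrite gt_eqF.
  by rewrite invr_eq0 gt_eqF.
have [vy ry _ _ _] := A_neq0 _ An0.
have [al Ay al0] := gam_A_fin _ gy An0 uy.
rewrite (gamE _ _ Ay)// /sig Ay -/(rho y) !inver !gt_eqF ?powR_gt0// -!EFinM.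
rewrite poweR_EFin inver gt_eqF ?powR_gt0 ?mulr_gt0 ?invr_gt0 ?powR_gt0//.
rewrite poweR_EFin -EFinM lee_fin mulrAC exp_identity_sig// mulrC //.
Qed.

Let T2 y := (w y `^ q^-1 * ball_int mu rho f y)%E.
(* [fine] sends [+oo] to 0, so [T1] vanishes where [gam] is infinite. *)
Let T1 y := maxe ((fine (gam y))%:E - T2 y)%E 0%E.

Lemma f_ge0 y : (0 <= f y)%E. Proof. by rewrite lee_fin mulr_ge0. Qed.

Lemma measurable_f : measurable_fun setT f.
Proof.
apply/measurable_EFinP; apply: measurable_funM => //.
exact: measurableT_comp.
Qed.

Lemma T2_ge0 y : (0 <= T2 y)%E.
Proof. by rewrite mule_ge0 ?poweR_ge0// ball_int_ge0//; exact: f_ge0. Qed.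

(** Where [A y] is positive and finite, [gam y] is [w^(1/q) * V * |u y|] and [T2 y] is [w^(1/q)]
    times the integral of [|u| v] over the ball. Their difference is thus at most [w^(1/q) * J],
    with [J] the integral of [|u - u y| v], and Cauchy-Schwarz applies to [J]. *)
Lemma T1_le y : (T1 y `^ q <= (2 `^ (s * q))%:E * e y)%E.
Proof.
have e0 : (0 <= (2 `^ (s * q))%:E * e y)%E.
  by rewrite mule_ge0 ?lee_fin ?powR_ge0// mule_ge0 ?poweR_ge0// lee_fin.
have [g0|gn0] := eqVneq (fine (gam y)) 0.
  by rewrite /T1 g0 sub0e max_r ?poweR0r ?gt_eqF// leeNl oppe0 T2_ge0.
have gy : (gam y < +oo)%E.
  by rewrite ltey; apply/eqP => gy; rewrite gy eqxx in gn0.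
have uy : u y != 0.
  by apply: contra_neq gn0 => uy; rewrite /gam /gfun uy mul0e mule0 abse0.
have An0 : A y != 0%E.
  apply: contra_neq gn0 => Ay; rewrite /gam /gfun -/A Ay poweR0r ?mul0e ?abse0//.
  by rewrite invr_eq0 gt_eqF.
have [al Ay al0] := gam_A_fin _ gy An0 uy.
have [be [io [nu [By Iy Vy [be0 io0 nu0 vy0] [ry alE]]]]] := A_fin_numP _ _ Ay al0.
have mS : measurable [set x | rho x < rho y].
  by apply: measurable_below; exact: measurable_rho.
pose S := [set x | rho x < rho y].
pose wy := al * (rho y `^ (s * q) * nu `^ q)^-1.
have wE : w y = wy%:E.
  rewrite /w Ay Vy poweR_EFin -EFinM inver gt_eqF ?mulr_gt0 ?powR_gt0//.
have wy0 : 0 < wy by rewrite mulr_gt0// invr_gt0 mulr_gt0// powR_gt0.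
have mJ : measurable_fun setT (fun x => (`|u x - u y| * v x)%:E).
  apply/measurable_EFinP; apply: measurable_funM => //.
  by apply: measurableT_comp => //; exact: measurable_funB.
pose J := (\int[mu]_(x in S) (`|u x - u y| * v x)%:E)%E.
have J0 : (0 <= J)%E by apply: integral_ge0 => x _; rewrite lee_fin mulr_ge0.
(* The triangle inequality is kept in additive form because the integral of [|u| v] may be
   infinite. *)
have VJ : ((`|u y| * nu)%:E <= J + ball_int mu rho f y)%E.
  rewrite EFinM -Vy /V /ball_int -ge0_integralZl_EFin//; last 2 first.
    by move=> x _; rewrite lee_fin.
    by apply: measurable_funTS; exact/measurable_EFinP.
  rewrite -ge0_integralD//; last 4 first.
    by move=> x _; rewrite lee_fin mulr_ge0.
    exact: measurable_funTS.
    by move=> x _; exact: f_ge0.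
    by apply: measurable_funTS; exact: measurable_f.
  apply: ge0_le_integral => //.
  - by move=> x _; rewrite mule_ge0 ?lee_fin.
  - apply: emeasurable_funM => //; apply: measurable_funTS; exact/measurable_EFinP.
  - apply: emeasurable_funD; apply: measurable_funTS => //; exact: measurable_f.
  move=> x _; rewrite -EFinM -EFinD lee_fin -mulrDl ler_wpM2r//.
  by rewrite [leRHS]addrC -{1}(subKr (u x) (u y)) ler_normB.
pose Pd x := ((u x - u y) ^+ 2 * z x)%:E.
have Pd0 x : (0 <= Pd x)%E by rewrite lee_fin mulr_ge0// sqr_ge0.
have mPd : measurable_fun setT Pd.
  apply/measurable_EFinP; apply: measurable_funM => //.
  by apply: measurable_funX; exact: measurable_funB.
pose P := (\int[mu]_(x in S) Pd x)%E.
have P0 : (0 <= P)%E by exact: integral_ge0.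
have CS : (J <= P `^ 2^-1 * (io `^ 2^-1)%:E)%E.
  rewrite -poweR_EFin -Iy; apply: hoelder_ae => //.
  - exact: measurable_Idens.
  - by move=> x; rewrite lee_fin mulr_ge0.
  - exact: Idens_ge0.
  - by lra.
  - by rewrite -/(ball_int mu rho Idens y) -/(I y) Iy ltry.
  apply: aeW => x _ Qx.
  (* Where [z] vanishes, [v^2 / z] is [+oo] unless [v] vanishes too, and Hoelder asks nothing at
     points of infinite density. *)
  have [z00|zn0] := eqVneq (z x) 0.
    have [->|vx0] := eqVneq (v x) 0.
      by rewrite mulr0 mule_ge0 ?poweR_ge0.
    move: Qx; rewrite /Idens z00 inve0 gt0_muley ?ltxx// lte_fin exprn_gt0//.
    by rewrite lt0r vx0 v0.
  have zx : 0 < z x by rewrite lt0r zn0 z0.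
  rewrite -poweRM//; last exact: Idens_ge0.
  have -> : (Pd x * Idens x = ((`|u x - u y| * v x) ^+ 2)%:E)%E.
    rewrite /Pd /Idens inver (negPf zn0) -!EFinM; congr EFin.
    by rewrite exprMn real_normK ?num_real//; field.
  rewrite poweR_EFin lee_fin.
  by rewrite powR12_sqrt ?sqr_ge0// sqrtr_sqr (ger0_norm (_ : 0 <= `|u x - u y| * v x)) ?mulr_ge0.
pose c := ((2 * rho y) `^ (2 * s) * be)^-1.
have r20 : 0 < 2 * rho y by rewrite mulr_gt0.
have c0 : 0 < c by rewrite invr_gt0 mulr_gt0// powR_gt0.
have s20 : 0 <= 2 * s by rewrite mulr_ge0// ltW.
have Pe : ((c `^ (q / 2) * v y)%:E * P `^ (q / 2) <= e y)%E.
  rewrite EFinM muleAC; apply: lee_wpmul2r; first by rewrite lee_fin.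
  rewrite -poweR_EFin -poweRM ?lee_fin ?(ltW c0)//.
  apply: le_poweR; [by rewrite divr_ge0// ltW|by rewrite mule_ge0 ?lee_fin ?(ltW c0)|].
  rewrite /P -ge0_integralZl_EFin//; [|exact: measurable_funTS|exact: ltW].
  rewrite integral_mkcond; apply: ge0_le_integral_nonmeas => x.
    by apply: erestrict_ge0 => t _; rewrite mule_ge0// lee_fin ltW.
  have den0 : (0 <= ((dist x y `^ (2 * s))%:E * mu (mball dist a (dist x y / 2)))^-1)%E.
    by rewrite inve_ge0 mule_ge0// lee_fin powR_ge0.
  have [/= xy|nxy] := pselect (S x); last first.
    have -> : ((fun t => c%:E * Pd t)%E \_ S) x = 0%E by rewrite patchE memNset.
    exact: (mule_ge0 (Pd0 x) den0).
  rewrite patchE mem_set// muleC; apply: (lee_wpmul2l (Pd0 x)).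
  have dxy : dist x y < 2 * rho y.
    have := dist_triangle x a y; rewrite (dist_sym x a) -/(rho x) -/(rho y).
    by have : rho x < rho y := xy; lra.
  have -> : c%:E = (((2 * rho y) `^ (2 * s) * be)%:E)^-1%E.
    by rewrite inver gt_eqF// mulr_gt0// powR_gt0.
  apply: le_inve; first by rewrite mule_ge0// lee_fin powR_ge0.
  rewrite EFinM; apply: lee_pmul => //; first by rewrite lee_fin powR_ge0.
    rewrite lee_fin; apply: ge0_ler_powR; rewrite ?nnegrE ?dist_ge0//.
      exact: ltW.
    exact: ltW.
  rewrite -By /B mballE; apply: le_measure; rewrite ?inE//.
    by apply: measurable_below; exact: measurable_rho.
  by move=> t /= tr; apply: lt_trans tr _; rewrite ltr_pdivrMr// mulrC.
have T1J : (T1 y <= (wy `^ q^-1)%:E * J)%E.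
  have wJ0 : (0 <= (wy `^ q^-1)%:E * J)%E by rewrite mule_ge0// lee_fin powR_ge0.
  have gT : ((fine (gam y))%:E <= (wy `^ q^-1)%:E * J + T2 y)%E.
    have bf0 : (0 <= ball_int mu rho f y)%E by apply: ball_int_ge0; exact: f_ge0.
    rewrite /T2 wE poweR_EFin -ge0_muleDr//.
    apply: le_trans (lee_wpmul2l _ VJ); last by rewrite lee_fin powR_ge0.
    rewrite (gamE _ _ Ay)// -EFinM lee_fin /wy.
    rewrite powRM ?invr_ge0 ?mulr_ge0 ?powR_ge0 ?(ltW al0)// exp_identity_root//.
    rewrite [leRHS](_ : _ = al `^ q^-1 * (rho y `^ s)^-1 * `|u y|)//.
    by field; rewrite !gt_eqF// powR_gt0.
  rewrite /T1 ge_max wJ0 andbT.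
  have [T2y|T2n] := eqVneq (T2 y) +oo%E.
    by rewrite T2y addeNy leNye.
  by rewrite leeBlDr// ge0_fin_numE ?ltey// T2_ge0.
apply: le_trans (_ : ((wy `^ q^-1)%:E * (P `^ 2^-1 * (io `^ 2^-1)%:E)) `^ q <= _)%E.
  apply: le_poweR; [exact: ltW|by rewrite /T1 le_max lexx orbT|].
  by apply: le_trans T1J _; apply: lee_wpmul2l => //; rewrite lee_fin powR_ge0.
apply: le_trans (lee_wpmul2l _ Pe); last by rewrite lee_fin powR_ge0.
rewrite !poweRM ?mule_ge0 ?poweR_ge0 ?lee_fin ?powR_ge0//.
rewrite -poweRrM !poweR_EFin -!powRrM mulVf ?gt_eqF// powRr1 ?(ltW wy0)//.
rewrite [2^-1 * q]mulrC [(P `^ _ * _)%E]muleC !muleA -!EFinM /wy alE.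
by rewrite (exp_identity_energy 2)// lexx.
Qed.


Lemma measurable_T2 : measurable_fun setT T2.
Proof.
apply: emeasurable_funM; first by apply: measurable_poweR_fun; exact: measurable_w.
by apply: measurable_ball_int; [exact: measurable_rho|exact: measurable_f|exact: f_ge0].
Qed.

Lemma gam_le_T1T2 y : (gam y < +oo)%E -> (gam y <= T1 y + T2 y)%E.
Proof.
move=> gy; have gf : gam y \is a fin_num by rewrite ge0_fin_numE ?abse_ge0.
rewrite -{1}(fineK gf) -[leLHS]adde0 /T1.
have [T2y|T2n] := eqVneq (T2 y) +oo%E.
  rewrite T2y addey ?leey// gt_eqF// (@lt_le_trans _ _ 0%E)//.
  by rewrite le_max lexx orbT.
have T2f : T2 y \is a fin_num by rewrite ge0_fin_numE ?ltey// T2_ge0.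
by rewrite adde0 -leeBlDr// le_max lexx.
Qed.

(** With [N] the integral of [gam^q], the [T2] part contributes at most
    [k^(1 - q) * k^q * N = k * N]. As [N] is finite, this is moved to the left, which produces the
    factor [(1 - k)^-1]. *)
Lemma integral_gam_le_energy (D k : R) : 0 <= D ->
  (forall x, x != a -> D1_at mu dist a s q v z x <= D%:E)%E ->
  (qconj q `^ (qconj q)^-1) * (q `^ q^-1) * D <= k -> 0 < k -> k < 1 ->
  measurable_fun setT (gfun mu dist a s q v z u) ->
  (\int[mu]_x (gam x `^ q) < +oo)%E ->
  (\int[mu]_x (gam x `^ q) <=
    ((1 - k)^-1 * ((1 - k) `^ (1 - q) * 2 `^ (s * q)))%:E * energy mu dist a s q v z u)%E.
Proof.
move=> D0 HD Kk k0 k1 mg Nfin.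
have mrho := measurable_rho.
have mgam : measurable_fun setT gam by exact: measurableT_comp.
have gam0 y : (0 <= gam y)%E by exact: abse_ge0.
have mT2 := measurable_T2.
have mT1 : measurable_fun setT T1.
  apply: measurable_maxe => //; apply: emeasurable_funB => //.
  by apply/measurable_EFinP; exact: measurableT_comp.
have T10 y : (0 <= T1 y)%E by rewrite /T1 le_max lexx orbT.
have T20 y : (0 <= T2 y)%E by exact: T2_ge0.
have k1' : 0 < 1 - k by rewrite subr_gt0.
(* Points with infinite [gam], where [fine] makes [T1] vanish, are negligible. *)
have gamfin : {ae mu, forall y, (gam y < +oo)%E}.
  have : mu.-integrable setT (fun x => gam x `^ q)%E.
    apply/integrableP; split; first exact: measurable_poweR_fun.
    by under eq_integral do rewrite gee0_abs ?poweR_ge0//.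
  move=> /(integrable_ae measurableT); apply: filterS => y /(_ Logic.I) Hy.
  apply: (@lty_poweRy _ _ q); first by rewrite gt_eqF.
  by rewrite -ge0_fin_numE ?poweR_ge0.
have bE : (qconj q)^-1 = (q - 1) / q by rewrite /qconj invf_div.
have hardy : (\int[mu]_y (T2 y `^ q) <= (k `^ q)%:E * \int[mu]_x (gam x `^ q))%E.
  rewrite (eq_integral (fun y => w y * ball_int mu rho f y `^ q)%E); last first.
    move=> y _; rewrite /T2 poweRM ?poweR_ge0 ?ball_int_ge0//; last exact: f_ge0.
    by rewrite -poweRrM mulVf ?gt_eqF// poweRe1// w_ge0.
  apply: le_trans (weighted_hardy mu rho mrho w sig gam f q q^-1 (qconj q)^-1 D _ _ _ _ _ _ _ _ _ _ _ _ _ _ _ _) _.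
  - exact: dist_ge0.
  - exact: measurable_w.
  - exact: w_ge0.
  - exact: measurable_sig.
  - exact: sig_ge0.
  - exact: mgam.
  - exact: gam0.
  - exact: measurable_f.
  - exact: f_ge0.
  - by rewrite invr_gt0.
  - by rewrite invr_gt0 qconj_pos.
  - by rewrite bE; field; rewrite gt_eqF.
  - by rewrite mulVf// gt_eqF.
  - exact: D0.
  (* The supremum in [D1] omits [x = a]; the open ball there is empty, so the product is 0. *)
  - move=> x; have [->|xa] := eqVneq x a; last by rewrite -D1_atE; exact: HD.
    have -> : ball_int mu rho sig a = 0%E.
      rewrite /ball_int (_ : [set x | rho x < rho a] = set0) ?integral_set0//.
      apply/seteqP; split => t //=; have -> : rho a = 0.
        by case: metric => _ [/(_ a a)[_ h] _]; exact: h.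
      by rewrite ltNge dist_ge0.
    by rewrite poweR0r ?mule0 ?lee_fin// invr_eq0 gt_eqF// qconj_pos.
  - by apply: filterS gamfin => y gy sy; exact: f_le_gam_sig.
  apply: lee_wpmul2r; first by apply: integral_ge0 => x _; exact: poweR_ge0.
  rewrite lee_fin invrK.
  have qc0 := qconj_pos.
  rewrite [leLHS](_ : _ = ((qconj q `^ (qconj q)^-1) * (q `^ q^-1) * D) `^ q).
    apply: ge0_ler_powR; rewrite ?nnegrE ?mulr_ge0 ?powR_ge0 ?(ltW q0) ?(ltW k0)//.
  move: qc0 bE; move: (qconj q) => p p0 bE.
  rewrite !powRM ?mulr_ge0 ?powR_ge0// -!powRrM bE mulfVK ?gt_eqF//.
  by rewrite mulVf ?gt_eqF// powRr1// ltW.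
have T1e : (\int[mu]_y (T1 y `^ q) <= (2 `^ (s * q))%:E * energy mu dist a s q v z u)%E.
  have c0 : 0 < 2 `^ (s * q) :> R by rewrite powR_gt0.
  (* The constant is moved onto [T1], the measurable side, since the integrand of the energy need
     not be measurable. *)
  rewrite muleC -lee_pdivrMr// muleC -ge0_integralZl_EFin//; last 2 first.
    by move=> y _; exact: poweR_ge0.
    exact: measurable_poweR_fun.
  apply: ge0_le_integral_nonmeas => y; first by rewrite mule_ge0 ?poweR_ge0// lee_fin invr_ge0 ltW.
  by rewrite muleC lee_pdivrMr// muleC; exact: T1_le.
set N := (\int[mu]_x (gam x `^ q))%E in hardy Nfin *.
have split : (N <= ((1 - k) `^ (1 - q))%:E * \int[mu]_y (T1 y `^ q) + k%:E * N)%E.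
  have kk : k `^ (1 - q) * k `^ q = k.
    by rewrite -powRD ?subrK ?powRr1 ?(ltW k0)// gt_eqF ?implybT.
  have c1 : (0 <= ((1 - k) `^ (1 - q))%:E)%E by rewrite lee_fin powR_ge0.
  have c2 : (0 <= (k `^ (1 - q))%:E)%E by rewrite lee_fin powR_ge0.
  rewrite -{2}kk EFinM -muleA.
  apply: (@le_trans _ _ (((1 - k) `^ (1 - q))%:E * \int[mu]_y (T1 y `^ q) +
      (k `^ (1 - q))%:E * \int[mu]_y (T2 y `^ q)))%E; last first.
    by apply: leeD => //; exact: (lee_wpmul2l c2 hardy).
  have mp (h : T -> \bar R) : measurable_fun setT h -> measurable_fun setT (fun y => h y `^ q)%E.
    exact: measurable_poweR_fun.
  rewrite -!ge0_integralZl//; [|exact: mp|by move=> y _; exact: poweR_ge0|exact: mp|by move=> y _; exact: poweR_ge0].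
  rewrite -ge0_integralD//;
    [|by move=> y _; rewrite mule_ge0// poweR_ge0|by apply: emeasurable_funM => //; exact: mp
     |by move=> y _; rewrite mule_ge0// poweR_ge0|by apply: emeasurable_funM => //; exact: mp].
  apply: ae_ge0_le_integral => //.
  - by move=> y _; exact: poweR_ge0.
  - exact: mp.
  - by move=> y _; rewrite adde_ge0// mule_ge0// poweR_ge0.
  - by apply: emeasurable_funD; apply: emeasurable_funM => //; exact: mp.
  apply: filterS gamfin => y gy _.
  apply: le_trans (le_poweR _ _ _ (ltW q0) (gam0 y) (gam_le_T1T2 _ gy)) _.
  by apply: poweRD_le_split => //; move: q2; lra.
have N0 : (0 <= N)%E by apply: integral_ge0 => x _; exact: poweR_ge0.
have [n nE] : exists n, N = n%:E by exists (fine N); rewrite fineK// ge0_fin_numE.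
move: split; rewrite nE -EFinM -leeBlDr// -EFinB.
have -> : n - k * n = (1 - k) * n by ring.
rewrite EFinM -lee_pdivlMl// => /le_trans; apply.
rewrite EFinM -muleA; apply: lee_wpmul2l; first by rewrite lee_fin invr_ge0 ltW.
by rewrite EFinM -muleA; apply: lee_wpmul2l => //; rewrite lee_fin powR_ge0.
Qed.

End TestFunction.
End EnergyBound.

Theorem theorem2p6 (R : realType) (d : measure_display) (T : measurableType d)
  (mu : {measure set T -> \bar R}) (dist : T -> T -> R) (a : T)
  (s q : R) (v z : T -> R) :
  is_metric dist ->
  borel_sets_measurable dist ->
  polar_decomposition mu dist a ->
  0 < s -> 2 < q ->
  (forall x, 0 <= v x) -> (forall x, 0 <= z x) ->
  measurable_fun setT v -> measurable_fun setT z ->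
  (D1 mu dist a s q v z < +oo)%E ->
  (((qconj q `^ (qconj q)^-1) * (q `^ q^-1))%:E * D1 mu dist a s q v z < 1)%E ->
  exists C : R, 0 < C /\
    forall u : T -> R, measurable_fun setT u ->
      let g := gfun mu dist a s q v z u in
      inLp mu 1 g -> inLp mu 2 g -> inLp mu q g ->
      ~ {ae mu, forall x, g x = 0%E} ->
      (enorm mu 2 g `^ (4 - 4 / q) <=
       C%:E * (energy mu dist a s q v z u `^ (2 / q))
            * enorm mu 1 g `^ (2 * (q - 2) / q))%E.
Proof.
move=> metric borel _ s0 q2 v0 z0 mv mz Dfin KD1.
have q0 : 0 < q by exact: lt_trans q2.
(* If [a] is the only point, [D1] is a supremum over the empty set, hence [-oo]; the maximum with 0
   covers this case. *)
pose D := fine (maxe (D1 mu dist a s q v z) 0%E).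
have DE : (maxe (D1 mu dist a s q v z) 0 = D%:E)%E.
  rewrite /D fineK// ge0_fin_numE ?le_max ?lexx ?orbT//.
  by rewrite gt_max Dfin ltry.
have D0 : 0 <= D by rewrite -lee_fin -DE le_max lexx orbT.
have HD x : x != a -> (D1_at mu dist a s q v z x <= D%:E)%E.
  by move=> xa; rewrite -DE le_max ereal_sup_ubound//; exists x.
pose K := (qconj q `^ (qconj q)^-1) * (q `^ q^-1) * D.
have K1 : K < 1.
  rewrite /K; have [D10|D10] := leP (D1 mu dist a s q v z) 0%E.
    by have -> : D = 0; [rewrite /D max_r|rewrite mulr0].
  by rewrite -lte_fin EFinM -DE max_l// ltW.
(* [K] may be 0, whereas the splitting weight [k] must lie strictly between 0 and 1. *)
pose k := Num.max K 2^-1.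
have k0 : 0 < k by rewrite lt_max invr_gt0 ltr0n orbT.
have k1 : k < 1 by rewrite gt_max K1 invf_lt1// ltr1n.
have Kk : K <= k by rewrite le_max lexx.
have k1' : 0 < 1 - k by rewrite subr_gt0.
pose C0 := (1 - k)^-1 * ((1 - k) `^ (1 - q) * 2 `^ (s * q)).
have C00 : 0 < C0 by rewrite !mulr_gt0 ?invr_gt0 ?powR_gt0.
(* The interpolation takes the integral of [|g|^q], bounded by [C0] times the energy, to the power
   [2 / q]. *)
exists (C0 `^ (2 / q)); split; first exact: powR_gt0.
move=> u meas_u g _ _ [mg gq] _.
have gE := integral_gam_le_energy mu dist a s q v z metric borel s0 q2 v0 z0 mv mz
  u meas_u D k D0 HD Kk k0 k1 mg gq.
apply: le_trans (enorm_interpolation _ _ _ q2 mg gq) _.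
apply: lee_wpmul2r; first exact: poweR_ge0.
have e0 : (0 <= energy mu dist a s q v z u)%E.
  by apply: integral_ge0 => y _; rewrite mule_ge0 ?poweR_ge0// lee_fin.
rewrite -poweR_EFin -poweRM ?lee_fin ?(ltW C00)//.
apply: le_poweR => //; first by rewrite divr_ge0// ltW.
by apply: integral_ge0 => y _; exact: poweR_ge0.
Qed.
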